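(* Let $T \in \mathcal{B}(\mathcal{H})$. Then for any Orlicz function $\phi$, \[\phi\left(w^2(T)\right) \leq \frac{1}{2} \min \left\{ \phi\left(w\left(|T||T^*|\right)\right), \phi\left(w(T^2)\right)\right \} + \frac{1}{4} \left\|\phi(|T|^2) + \phi(|T^*|^2) \right\|.\]
   Context: $\mathcal{B}(\mathcal{H})$ is the algebra of bounded linear operators on a complex Hilbert space $\mathcal{H}$. For $T\in\mathcal{B}(\mathcal{H})$, $T^*$ is the adjoint, $|T|=(T^*T)^{1/2}$, $|T^*|=(TT^* )^{1/2}$, $\|T\|$ is the operator norm, $w(T)=\sup_{\|x\|=1}|\langle Tx,x\rangle|$ is the numerical radius, and $w^2(T)=(w(T))^2$. For a positive operator $A$, $\phi(A)$ is defined by the continuous functional calculus. An Orlicz function is a continuous, convex, increasing function $\phi:[0,\infty)\to[0,\infty)$ with $\phi(0)=0$, $\phi(t)>0$ for all $t>0$, and $\lim_{t\to\infty}\phi(t)=\infty$. *)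

(* Defs.v *)
From HB Require Import structures.
From mathcomp Require Import all_boot all_order all_algebra sesquilinear.
From mathcomp Require Import all_classical all_reals all_analysis.
From mathcomp Require Import complex.

Set Implicit Arguments.
Unset Strict Implicit.
Unset Printing Implicit Defensive.

Import Order.TTheory GRing.Theory Num.Theory numFieldNormedType.Exports.

Local Open Scope classical_set_scope.
Local Open Scope complex_scope.
Local Open Scope ring_scope.

(* [{dot H for conjC}] is linear in its first argument and conjugate-linear in
   its second one. *)
HB.mixin Record CompleteNormedModule_isHilbert (R : realType) (H : Type)
    of CompleteNormedModule R[i] H := {
  inner : {dot H for (@Num.conj R[i])} ;
  inner_norm : forall x : H, inner x x = `|x| ^+ 2 }.

#[short(type="hilbertType")]
HB.structure Definition Hilbert (R : realType) :=
  {H of CompleteNormedModule_isHilbert R H & CompleteNormedModule R[i] H}.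

Section operators.
Variables (R : realType) (H : hilbertType R).
Implicit Types (A B S T : H -> H) (f : R -> R).

Definition bounded_op T :=
  linear T /\ exists M : R[i], forall x, `|T x| <= M * `|x|.

(* The norm of [H] and the modulus of [R[i]] take values in [R[i]]; [complex.Re]
   brings them back to [R].  The closed unit ball, unlike the unit sphere, is
   nonempty even if [H] is trivial. *)
Definition opnorm T : R :=
  sup [set complex.Re `|T x| | x in [set x | `|x| <= 1]].

(* If [H] is trivial the unit sphere is empty and [sup set0 = 0]. *)
Definition numradius T : R :=
  sup [set complex.Re `|inner (T x) x| | x in [set x | `|x| = 1]].

Definition is_adjoint T S :=
  bounded_op S /\ forall x y, inner (T x) y = inner x (S y).

Definition adjoint T : H -> H := xget (fun=> 0) [set S | is_adjoint T S].

(* The order of [R[i]] makes [0 <= z] mean that [z] is real and nonnegative. *)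
Definition positive_op A := bounded_op A /\ forall x, 0 <= inner (A x) x.

Definition sqrt_op A : H -> H :=
  xget (fun=> 0) [set S | positive_op S /\ S \o S = A].

Definition abs_op T : H -> H := sqrt_op (adjoint T \o T).

Definition spectrum A : set R[i] :=
  [set l | ~ exists S, [/\ bounded_op S,
     forall x, S (A x - l *: x) = x & forall x, A (S x) - l *: S x = x]].

Definition horner_op (p : {poly R}) A : H -> H :=
  fun x => \sum_(i < size p) (p`_i)%:C *: iter i A x.

(* [B = f(A)] for [A] self-adjoint: [B] is the limit in operator norm of
   polynomials [p_n(A)], where [p_n] converges to [f] uniformly on the spectrum
   of [A].  That spectrum is real, so real points and, [f] being real-valued,
   real polynomials are enough. *)
Definition is_funcalc f A B :=
  bounded_op B /\ exists p : nat -> {poly R},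
    {uniform [set t : R | spectrum A t%:C],
      (fun n t => (p n).[t]) @ \oo --> f} /\
    opnorm (fun x => horner_op (p n) A x - B x) @[n --> \oo] --> (0 : R).

Definition funcalc f A : H -> H := xget (fun=> 0) [set B | is_funcalc f A B].

End operators.

(* A function on [0, +oo[ is encoded by a function on [R] whose values at
   negative reals are irrelevant. *)
Record orlicz (R : realType) (phi : R -> R) : Prop := Orlicz {
  orlicz_ge0 : forall t, 0 <= t -> 0 <= phi t ;
  orlicz_continuous : {within `[0, +oo[, continuous phi} ;
  orlicz_convex : convex_function (`[0, +oo[%classic : set R^o) phi ;
  orlicz_increasing : {in `[0, +oo[ &, {homo phi : s t / s <= t}} ;
  orlicz0 : phi 0 = 0 ;
  orlicz_gt0 : forall t, 0 < t -> 0 < phi t ;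
  orlicz_pinfty : phi t @[t --> +oo] --> +oo }.

(* Main.v *)
(* Buzano's inequality bounds [|<T x, x>|^2] by
   [w / 2 + (|T x|^2 + |T^* x|^2) / 4], where [w = w(T^2)] when it is applied to
   [T x] and [T^* x], and [w = w(|T| |T^*|)] when it is applied to [|T| x] and
   [|T^*| x] after the mixed Schwarz inequality
   [|<T x, x>|^2 <= <|T| x, x> <|T^*| x, x>].  Convexity of [phi], and Jensen's
   inequality [phi <A x, x> <= <phi(A) x, x>] for [A = |T|^2] and [A = |T^*|^2],
   then give the bound.

   The adjoint comes from the Riesz representation theorem.  The functional calculus
   rests on one fact: a real polynomial that is nonnegative on the approximate point
   spectrum of a self-adjoint [A] gives a nonnegative operator.  With Weierstrass
   approximation it yields [f(A)] for [f] continuous on [[0, M]] when [0 <= A <= M],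
   in particular square roots and resolvents. *)

Require Import Defs.
From mathcomp Require Import all_boot all_order all_algebra sesquilinear.
From mathcomp Require Import all_classical all_reals all_analysis.
From mathcomp Require Import complex ring lra.
Set Implicit Arguments.
Unset Strict Implicit.
Unset Printing Implicit Defensive.

Import Order.TTheory GRing.Theory Num.Theory numFieldNormedType.Exports.

Local Open Scope ring_scope.

Local Notation Re := complex.Re.
Local Notation Im := complex.Im.
Local Notation "x %:C" := (real_complex _ x) : ring_scope.

(** [abs_op] and [funcalc] are picked by [xget], so only their defining properties are available and
    each argument has to hold for every admissible choice. For [|T|] everything is drawn from the
    value of its square: any positive [P] is a norm limit of polynomials in [P \o P], which gives
    the intertwining of square roots. For [phi(A)] the polynomials converge on the spectrum only, so
    Jensen's inequality has to test positivity there and not on an interval around it.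

    The approximate point spectrum is used because its complement is quantitative: being bounded
    below survives composition, so it passes from the linear factors of a polynomial to the
    polynomial itself, before any inverse has been constructed. Inverses come afterwards, as [fcalc]
    of the function sending [s] to [(s - t)^-1] on [[0, M]]. They place the real spectrum inside
    [[0, M]], and this turns [fcalc] into [is_funcalc]. *)

Section RealNumbers.
Variable R : realType.

Lemma inv_nat_small (e : R) : 0 < e ->
  exists N : nat, forall n, (N <= n)%N -> n.+1%:R^-1 <= e.
Proof.
move=> e0; exists (Num.truncn e^-1) => n Nn.
rewrite invf_ple ?posrE// ltW// (lt_le_trans (truncnS_gt _))//.
by rewrite ler_nat ltnS.
Qed.

(** Limit arguments end here: the error may be any fixed multiple of [e], which avoids rescaling [e]
    beforehand. *)
Lemma ler_small (a b c : R) : 0 <= c ->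
  (forall e : R, 0 < e -> a <= b + e * c) -> a <= b.
Proof.
move=> c0 h; apply/ler_addgt0Pl => e e0.
have c1 : 0 < c + 1 by lra.
rewrite addrC (le_trans (h _ (divr_gt0 e0 c1)))// lerD2l.
by rewrite mulrAC ler_pdivrMr// mulrDr mulr1 lerDl ltW.
Qed.

Lemma quadratic_ge0_discr (a b c : R) : 0 <= a -> 0 <= b ->
  (forall s : R, 0 <= a + 2 * s * c + s ^+ 2 * b) -> c ^+ 2 <= a * b.
Proof.
move=> a0 b0 h; have [b_eq0|b_neq0] := eqVneq b 0.
  have [->|c0] := eqVneq c 0; first by rewrite expr0n mulr_ge0.
  (* For [b = 0] the expression is affine in [s], and this [s] gives it the value -1. *)
  have := h (- (a + 1) / (2 * c)); rewrite b_eq0 mulr0 addr0.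
  have -> : 2 * (- (a + 1) / (2 * c)) * c = - (a + 1) by field.
  lra.
have b_gt0 : 0 < b by rewrite lt_def b_neq0.
have := h (- c / b).
have -> : a + 2 * (- c / b) * c + (- c / b) ^+ 2 * b = (a * b - c ^+ 2) / b by field.
by rewrite pmulr_lge0 ?invr_gt0// subr_ge0.
Qed.

End RealNumbers.

(** * Moduli of complex numbers as real numbers *)

Section ComplexNumbers.
Variable R : realType.
Implicit Types (z w : R[i]) (a : R).

Lemma ReD z w : Re (z + w) = Re z + Re w. Proof. by case: z w => [? ?] [? ?]. Qed.
Lemma ReN z : Re (- z) = - Re z. Proof. by case: z. Qed.
Lemma ReM z w : Re (z * w) = Re z * Re w - Im z * Im w.
Proof. by case: z w => [? ?] [? ?]. Qed.
Lemma ReZ a z : Re (a%:C * z) = a * Re z.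
Proof. by rewrite ReM /= mul0r subr0. Qed.
Lemma ReJ z : Re (Num.conj z) = Re z. Proof. by case: z. Qed.

Lemma norm_Re z : `|z| = (Re `|z|)%:C. Proof. by rewrite normc_def. Qed.

Lemma Re_norm z : Re `|z| = Num.sqrt (Re z ^+ 2 + Im z ^+ 2).
Proof. by rewrite normc_def. Qed.

Lemma Re_norm_ge0 z : 0 <= Re `|z|. Proof. by rewrite Re_norm sqrtr_ge0. Qed.

Lemma Re_normM z w : Re `|z * w| = Re `|z| * Re `|w|.
Proof. by rewrite normrM (norm_Re z) (norm_Re w) -rmorphM. Qed.

Lemma Re_normJ z : Re `|Num.conj z| = Re `|z|. Proof. by rewrite norm_conjC. Qed.

Lemma Re_normr a : Re `|a%:C| = `|a|.
Proof. by rewrite Re_norm /= expr0n addr0 sqrtr_sqr. Qed.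

Lemma ler_Re z : Re z <= Re `|z|.
Proof.
rewrite Re_norm (le_trans (ler_norm _))// -sqrtr_sqr ler_sqrt ?lerDl ?sqr_ge0//.
by rewrite addr_ge0 ?sqr_ge0.
Qed.

Lemma Re_normD z w : Re `|z + w| <= Re `|z| + Re `|w|.
Proof.
have := ler_normD z w.
by rewrite (norm_Re (z + w)) (norm_Re z) (norm_Re w) -rmorphD lecR.
Qed.

Lemma ge0_ReE z : 0 <= z -> z = (Re z)%:C.
Proof. by case: z => a b; rewrite lecE /= => /andP[/eqP -> _]. Qed.

Lemma Re_ge0 z : 0 <= z -> 0 <= Re z.
Proof. by rewrite lecE => /andP[]. Qed.

(** Reduces a bound on a modulus to a bound on a real part, after rotating one vector by [u]. *)
Lemma unimodular_rotation z : exists2 u : R[i], Re `|u| = 1 & Re (u * z) = Re `|z|.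
Proof.
have [->|z0] := eqVneq z 0.
  by exists 1; rewrite ?normr1 // mulr0 normr0.
have nz0 : `|z| != 0 by rewrite normr_eq0.
exists (Num.conj z / `|z|).
  by rewrite normrM normfV norm_conjC normr_id divff.
by rewrite mulrAC [_ * z]mulrC -normCK expr2 mulfK.
Qed.

End ComplexNumbers.

(** * Geometry of the Hilbert space over the reals *)

Section HilbertSpace.
Variables (R : realType) (H : hilbertType R).
Implicit Types (x y z : H) (a : R[i]) (r s : R).

(** With [nrm] and [rip] every estimate takes place in [R], where [lra] and [nra] apply. *)
Definition nrm x : R := Re `|x|.
Definition rip x y : R := Re (inner x y).

Lemma norm_nrm x : `|x| = (nrm x)%:C. Proof. exact/ge0_ReE/normr_ge0. Qed.
Lemma nrm_ge0 x : 0 <= nrm x. Proof. exact/Re_ge0/normr_ge0. Qed.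
Lemma nrm0 : nrm 0 = 0. Proof. by rewrite /nrm normr0. Qed.
Lemma nrm_eq0 x : nrm x = 0 -> x = 0.
Proof. by move=> n0; apply: normr0_eq0; rewrite norm_nrm n0. Qed.
Lemma nrmN x : nrm (- x) = nrm x. Proof. by rewrite /nrm normrN. Qed.
Lemma nrmB x y : nrm (x - y) = nrm (y - x). Proof. by rewrite /nrm distrC. Qed.
Lemma nrmD x y : nrm (x + y) <= nrm x + nrm y.
Proof. by have := ler_normD x y; rewrite !norm_nrm -rmorphD lecR. Qed.
Lemma nrmZ a x : nrm (a *: x) = Re `|a| * nrm x.
Proof. by rewrite {1}/nrm normrZ (norm_Re a) norm_nrm -rmorphM. Qed.
Lemma nrmZr r x : nrm (r%:C *: x) = `|r| * nrm x.
Proof. by rewrite nrmZ Re_normr. Qed.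

Lemma innerDl x y z : inner (x + y) z = inner x z + inner y z.
Proof. exact: linearDl. Qed.
Lemma innerDr x y z : inner x (y + z) = inner x y + inner x z.
Proof. exact: linearDr. Qed.
Lemma innerNl x y : inner (- x) y = - inner x y.
Proof. exact: linearNl. Qed.
Lemma innerNr x y : inner x (- y) = - inner x y.
Proof. exact: linearNr. Qed.
Lemma innerZl a x y : inner (a *: x) y = a * inner x y.
Proof. exact: linearZl_LR. Qed.
Lemma innerZr a x y : inner x (a *: y) = Num.conj a * inner x y.
Proof. exact: linearZr_LR. Qed.
Lemma innerC x y : inner x y = Num.conj (inner y x).
Proof. by rewrite hermC expr0 mul1r. Qed.
Lemma inner_nrm x : inner x x = (nrm x ^+ 2)%:C.
Proof. by rewrite inner_norm norm_nrm -rmorphXn. Qed.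

Lemma ripC x y : rip x y = rip y x.
Proof. by rewrite /rip innerC ReJ. Qed.
Lemma ripDl x y z : rip (x + y) z = rip x z + rip y z.
Proof. by rewrite /rip innerDl ReD. Qed.
Lemma ripDr x y z : rip x (y + z) = rip x y + rip x z.
Proof. by rewrite /rip innerDr ReD. Qed.
Lemma ripNl x y : rip (- x) y = - rip x y.
Proof. by rewrite /rip innerNl ReN. Qed.
Lemma ripNr x y : rip x (- y) = - rip x y.
Proof. by rewrite /rip innerNr ReN. Qed.
Lemma ripZl r x y : rip (r%:C *: x) y = r * rip x y.
Proof. by rewrite /rip innerZl ReZ. Qed.
Lemma ripZr r x y : rip x (r%:C *: y) = r * rip x y.
Proof. by rewrite ripC ripZl ripC. Qed.
Lemma ripxx x : rip x x = nrm x ^+ 2.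
Proof. by rewrite /rip inner_nrm. Qed.
Definition ripE := (ripDl, ripDr, ripNl, ripNr, ripZl, ripZr).

Lemma rip_CauchySchwarz x y : rip x y <= nrm x * nrm y.
Proof.
suff : rip x y ^+ 2 <= (nrm x * nrm y) ^+ 2.
  move=> h; rewrite (le_trans (ler_norm _))// -(ler_pXn2r (n := 2))//.
  - by rewrite real_normK ?num_real.
  - by rewrite nnegrE mulr_ge0 ?nrm_ge0.
rewrite exprMn; apply: quadratic_ge0_discr; rewrite ?sqr_ge0// => s.
rewrite -!ripxx; have : 0 <= rip (x + s%:C *: y) (x + s%:C *: y).
  by rewrite ripxx sqr_ge0.
rewrite !ripE (ripC y x); lra.
Qed.

Lemma inner_CauchySchwarz x y : Re `|inner x y| <= nrm x * nrm y.
Proof.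
have [u u1 <-] := unimodular_rotation (inner x y).
rewrite -innerZl (le_trans (rip_CauchySchwarz _ _))//.
by rewrite nrmZ u1 mul1r.
Qed.

Lemma rip_norm_CauchySchwarz x y : `|rip x y| <= nrm x * nrm y.
Proof.
rewrite ler_norml rip_CauchySchwarz andbT lerNl -ripNl -(nrmN x).
exact: rip_CauchySchwarz.
Qed.

Lemma nrm_eq x y : (forall e, 0 < e -> nrm (x - y) <= e) -> x = y.
Proof.
move=> h; apply/eqP; rewrite -subr_eq0; apply/eqP/nrm_eq0/eqP.
by rewrite eq_le nrm_ge0 andbT; apply/ler_addgt0Pl => e e0; rewrite addr0 h.
Qed.

Lemma nrm_complete (u : nat -> H) :
  (forall e, 0 < e -> exists N : nat, forall m n : nat,
      (N <= m)%N -> (N <= n)%N -> nrm (u m - u n) <= e) ->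
  exists l, forall e, 0 < e -> exists N : nat, forall n, (N <= n)%N -> nrm (u n - l) <= e.
Proof.
move=> u_cauchy; have /cauchy_cvgP : cauchy (u @ \oo)%classic.
  apply/cauchy_exP => e e0; have eE := ge0_ReE (ltW e0).
  have e2 : 0 < Re e / 2 by move: e0; rewrite eE ltcR => ?; lra.
  have [N hN] := u_cauchy _ e2; exists (u N), N => // n /= Nn.
  rewrite -ball_normE /ball_/= norm_nrm eE ltcR.
  by apply: le_lt_trans (hN N n _ _) _ => //; lra.
move=> u_cvg; have {u_cvg}/cvg_ex[l /cvgrPdist_lt ul] := u_cvg.
exists l => e e0; have e0C : 0 < e%:C by rewrite ltcR.
have [N _ hN] := ul _ e0C; exists N => n Nn.
by have := hN n Nn; rewrite /= norm_nrm ltcR nrmB => /ltW.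
Qed.

End HilbertSpace.

(** * Operator norm, Riesz representation, adjoints *)

Section BoundedOperators.
Variables (R : realType) (H : hilbertType R).
Implicit Types (x y z : H) (a : R[i]) (A B S T : H -> H).

Lemma linD A : linear A -> {morph A : x y / x + y}.
Proof. by move=> lA x y; have := lA 1 x y; rewrite !scale1r. Qed.

Lemma lin0 A : linear A -> A 0 = 0.
Proof. by move=> lA; apply: (addrI (A 0)); rewrite -linD// !addr0. Qed.

Lemma linZ A : linear A -> forall a x, A (a *: x) = a *: A x.
Proof. by move=> lA a x; have := lA a x 0; rewrite (lin0 lA) !addr0. Qed.

Lemma linN A : linear A -> {morph A : x / - x}.
Proof. by move=> lA x; rewrite -scaleN1r linZ// scaleN1r. Qed.

Lemma linB A : linear A -> {morph A : x y / x - y}.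
Proof. by move=> lA x y; rewrite linD// linN. Qed.

Lemma bounded_opP A : bounded_op A <->
  linear A /\ exists K : R, 0 < K /\ forall x, nrm (A x) <= K * nrm x.
Proof.
split=> -[lA [K hK]]; split=> //.
- exists (`|Re K| + 1); split=> [|x]; first by rewrite ltr_wpDl.
  have := hK x; rewrite !norm_nrm lecE ReM /= mulr0 subr0 => /andP[_] h.
  apply: (le_trans h); rewrite ler_wpM2r ?nrm_ge0//.
  by rewrite (le_trans (ler_norm _))// lerDl.
- by exists K%:C => x; rewrite !norm_nrm -rmorphM lecR; apply: hK.2.
Qed.

Lemma le1_nrm x : (`|x| <= 1) = (nrm x <= 1).
Proof. by rewrite norm_nrm -(rmorph1 (real_complex R)) lecR. Qed.

Lemma eq1_nrm x : (`|x| = 1) <-> (nrm x = 1).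
Proof.
rewrite norm_nrm -(rmorph1 (real_complex R)); split=> [|->//].
exact: complexI.
Qed.

Lemma opnorm_has_sup A : bounded_op A ->
  has_sup [set Re `|A x| | x in [set x : H | `|x| <= 1]]%classic.
Proof.
move=> /bounded_opP[lA [K [K0 hK]]]; split.
  by exists (nrm (A 0)); exists 0 => //=; rewrite normr0.
exists K => _ [x /= + <-]; rewrite le1_nrm => x1.
by rewrite (le_trans (hK x))// ler_piMr// ltW.
Qed.

Lemma opnorm_ub A x : bounded_op A -> nrm x <= 1 -> nrm (A x) <= opnorm A.
Proof.
move=> bA x1; apply: (sup_upper_bound (opnorm_has_sup bA)).
by exists x => //=; rewrite le1_nrm.
Qed.

Lemma opnorm_ge0 A : bounded_op A -> 0 <= opnorm A.
Proof.
by move=> bA; rewrite (le_trans (nrm_ge0 (A 0)))// opnorm_ub// nrm0 ler01.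
Qed.

Lemma nrm_scale1 x : x != 0 -> nrm ((nrm x)^-1%:C *: x) = 1.
Proof.
move=> x0; rewrite nrmZr ger0_norm ?invr_ge0 ?nrm_ge0// mulVf//.
by apply/eqP => /nrm_eq0 /eqP; rewrite (negPf x0).
Qed.

Lemma opnorm_bound A x : bounded_op A -> nrm (A x) <= opnorm A * nrm x.
Proof.
move=> bA; have [->|x0] := eqVneq x 0.
  by rewrite (lin0 bA.1) nrm0 mulr0.
have x1 : nrm ((nrm x)^-1%:C *: x) <= 1 by rewrite nrm_scale1.
have := opnorm_ub bA x1.
rewrite (linZ bA.1) nrmZr ger0_norm ?invr_ge0 ?nrm_ge0//.
rewrite ler_pdivrMl 1?mulrC// lt_def nrm_ge0 andbT.
by apply/eqP => /nrm_eq0 /eqP; rewrite (negPf x0).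
Qed.

Lemma opnorm_le A K : 0 <= K -> (forall x, nrm (A x) <= K * nrm x) ->
  opnorm A <= K.
Proof.
move=> K0 hK; apply: ge_sup.
  by exists (nrm (A 0)); exists 0 => //=; rewrite normr0.
move=> _ [x /= + <-]; rewrite le1_nrm => x1.
by rewrite (le_trans (hK x))// ler_piMr.
Qed.

Lemma bounded_opD A B : bounded_op A -> bounded_op B -> bounded_op (A \+ B).
Proof.
move=> /bounded_opP[lA [K [K0 hK]]] /bounded_opP[lB [L [L0 hL]]].
apply/bounded_opP; split=> [a x y /=|].
  by rewrite lA lB scalerDr addrACA.
exists (K + L); split=> [|x]; first exact: addr_gt0.
by rewrite mulrDl (le_trans (nrmD _ _))// lerD.
Qed.

Lemma bounded_opZ a A : bounded_op A -> bounded_op (fun x => a *: A x).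
Proof.
move=> /bounded_opP[lA [K [K0 hK]]]; apply/bounded_opP; split=> [b x y /=|].
  by rewrite lA scalerDr !scalerA mulrC.
exists ((Re `|a| + 1) * K); split=> [|x].
  by rewrite mulr_gt0// ltr_wpDl// Re_norm_ge0.
rewrite nrmZ -mulrA ler_pM ?Re_norm_ge0 ?nrm_ge0//.
by rewrite lerDl.
Qed.

Lemma bounded_opB A B : bounded_op A -> bounded_op B ->
  bounded_op (fun x => A x - B x).
Proof.
move=> bA /(bounded_opZ (-1)) bB; have := bounded_opD bA bB.
by congr (bounded_op _); apply/funext => x /=; rewrite scaleN1r.
Qed.

Lemma bounded_op_comp A B : bounded_op A -> bounded_op B -> bounded_op (A \o B).
Proof.
move=> /bounded_opP[lA [K [K0 hK]]] /bounded_opP[lB [L [L0 hL]]].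
apply/bounded_opP; split=> [a x y /=|]; first by rewrite lB lA.
exists (K * L); split=> [|x]; first exact: mulr_gt0.
by rewrite -mulrA (le_trans (hK _))//= ler_wpM2l// ltW.
Qed.

Lemma bounded_op_id : bounded_op (@id H).
Proof. by apply/bounded_opP; split=> //; exists 1; split=> // x; rewrite mul1r. Qed.

Lemma inner_inj x y : (forall z, inner z x = inner z y) -> x = y.
Proof.
move=> h; apply/eqP; rewrite -subr_eq0; apply/eqP/nrm_eq0/eqP.
by rewrite -sqrf_eq0 -ripxx /rip innerDr innerNr h subrr.
Qed.

(* Two approximate minimisers of [J z = |z|^2 / 2 - Re (f z)] are close, and the
   first-order condition at the minimum of [J] is the representation of [f]. *)
Lemma Riesz_representation (f : H -> R[i]) (K : R) :
  (forall x y, f (x + y) = f x + f y) -> (forall a x, f (a *: x) = a * f x) ->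
  (forall x, Re `|f x| <= K * nrm x) ->
  exists u, forall v, f v = inner v u.
Proof.
move=> fD fZ fK.
pose J z := nrm z ^+ 2 / 2 - Re (f z).
have J_lb z : - (K ^+ 2 / 2) <= J z.
  have := le_trans (ler_Re _) (fK z); have := sqr_ge0 (nrm z - K).
  rewrite /J; nra.
have J_inf : has_inf (range J).
  split; first by exists (J 0), 0.
  by exists (- (K ^+ 2 / 2)) => _ [z _ <-].
pose m := inf (range J).
have m_lb z : m <= J z by apply: ge_inf; [exact: J_inf.2 | exists z].
(* Expanding [J z <= J (z + s v) + d ^ 2 / 2] gives a quadratic in [s] that is nonnegative
   everywhere; its discriminant is the claim. *)
have near_crit z (d : R) : 0 <= d -> J z <= m + d ^+ 2 / 2 ->
    forall v, `|rip v z - Re (f v)| <= d * nrm v.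
  move=> d0 Jz v; suff h : (rip v z - Re (f v)) ^+ 2 <= d ^+ 2 * nrm v ^+ 2.
    rewrite -exprMn -[in leLHS]real_normK ?num_real// in h.
    by rewrite ler_pXn2r ?nnegrE ?mulr_ge0 ?nrm_ge0 in h.
  apply: quadratic_ge0_discr; rewrite ?sqr_ge0// => s.
  have := le_trans Jz (lerD (m_lb (z + s%:C *: v)) (lexx _)).
  rewrite /J fD fZ ReD ReZ -!ripxx !ripE (ripC z v); lra.
have /choice[u_ hu] (n : nat) : exists z, J z <= m + n.+1%:R^-1 ^+ 2 / 2.
  have d0 : 0 < n.+1%:R^-1 ^+ 2 / 2 :> R by rewrite divr_gt0// exprn_gt0.
  by have [_ [z _ <-] /ltW] := inf_adherent d0 J_inf; exists z.
have hcrit n v : `|rip v (u_ n) - Re (f v)| <= n.+1%:R^-1 * nrm v.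
  by apply: near_crit.
have [u hul] : exists l, forall e : R, 0 < e ->
    exists N : nat, forall n, (N <= n)%N -> nrm (u_ n - l) <= e.
  apply: nrm_complete => e e0.
  have [N hN] := inv_nat_small (divr_gt0 e0 (ltr0n R 2)).
  exists N => i j Ni Nj; set w := u_ i - u_ j.
  have hw : nrm w ^+ 2 <= e * nrm w.
    (* Tested on [w] itself, both terms are within [e / 2 * nrm w] of the same number [Re (f w)]. *)
    have -> : nrm w ^+ 2 = rip w (u_ i) - rip w (u_ j).
      by rewrite -ripxx {2}/w ripDr ripNr.
    have := hcrit i w; have := hcrit j w.
    have := ler_wpM2r (nrm_ge0 w) (hN _ Ni).
    have := ler_wpM2r (nrm_ge0 w) (hN _ Nj).
    move: (nrm w) (rip w _) (rip w _) (Re _) (i.+1%:R^-1) (j.+1%:R^-1).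
    move=> nw ri rj fw di dj qj qi.
    rewrite !ler_norml => /andP[hj _] /andP[_ hi].
    lra.
  have [->|w0] := eqVneq (nrm w) 0; first exact: ltW.
  by move: hw; rewrite expr2 ler_pM2r// lt_def w0 nrm_ge0.
have hRe v : Re (f v) = Re (inner v u).
  apply/eqP; rewrite -subr_eq0 -normr_le0; apply/ler_addgt0Pl => e e0.
  rewrite addr0.
  have v1 : 0 < nrm v + 1 by rewrite ltr_wpDl ?nrm_ge0.
  have d0 : 0 < e / 2 / (nrm v + 1) by rewrite !divr_gt0.
  have [N1 h1] := inv_nat_small d0; have [N2 h2] := hul _ d0.
  pose n := maxn N1 N2.
  have := hcrit n v; have := rip_norm_CauchySchwarz v (u_ n - u).
  have := ler_wpM2r (nrm_ge0 v) (h1 n (leq_maxl _ _)).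
  have := ler_wpM2l (nrm_ge0 v) (h2 n (leq_maxr _ _)).
  have : e / 2 / (nrm v + 1) * (nrm v + 1) = e / 2 by rewrite divfK ?gt_eqF.
  rewrite ripDr ripNr -[Re (inner v u)]/(rip v u); move: d0.
  move: (e / 2 / (nrm v + 1)) (nrm (u_ n - u)) (nrm v) (rip v (u_ n))
    (rip v u) (Re (f v)) (n.+1%:R^-1).
  move=> q nu nv r1 r2 fv d q0 eq_q q1 q2.
  rewrite !ler_norml => /andP[q3 q4] /andP[q5 q6]; apply/andP; split; lra.
(* The real part at ['i v] supplies the imaginary part at [v]. *)
exists u => v; have := hRe v; have := hRe ('i%C *: v).
rewrite fZ innerZl !ReM /=.
case: (f v) (inner v u) => [a b] [c d] /= h ->; congr (_ +i* _)%C.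
lra.
Qed.

Lemma adjoint_exists T : bounded_op T -> exists S, is_adjoint T S.
Proof.
move=> /bounded_opP[lT [K [K0 hK]]].
have /choice[S hS] (y : H) : exists u, forall x, inner (T x) y = inner x u.
  apply: (@Riesz_representation _ (K * nrm y)) => [x z|a x|x].
  - by rewrite (linD lT) innerDl.
  - by rewrite (linZ lT) innerZl.
  - rewrite (le_trans (inner_CauchySchwarz _ _))// mulrAC ler_wpM2r ?nrm_ge0//.
exists S; split=> //; apply/bounded_opP; split=> [a x y|].
  by apply: inner_inj => z; rewrite -hS !innerDr !innerZr !hS.
exists K; split=> // y; have [->|n0] := eqVneq (nrm (S y)) 0.
  by rewrite mulr_ge0 ?nrm_ge0 ?ltW.
have n1 : 0 < nrm (S y) by rewrite lt_def n0 nrm_ge0.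
rewrite -(ler_pM2r n1) -expr2 -ripxx /rip -hS.
rewrite (le_trans (rip_CauchySchwarz _ _))// mulrAC.
by rewrite ler_wpM2r ?nrm_ge0.
Qed.

Lemma adjointP T : bounded_op T -> is_adjoint T (adjoint T).
Proof. by move=> /adjoint_exists[S hS]; apply: (xgetPex _ (ex_intro _ S hS)). Qed.

Lemma adjointK T : bounded_op T -> adjoint (adjoint T) = T.
Proof.
move=> bT; have [bS hS] := adjointP bT; have [_ hSS] := adjointP bS.
apply/funext => y; apply: inner_inj => x.
by rewrite -hSS innerC -hS -innerC.
Qed.

End BoundedOperators.

(** * Polynomials of a self-adjoint operator and their positivity *)

Section PolynomialCalculus.
Variables (R : realType) (H : hilbertType R).
Implicit Types (x y : H) (a : R[i]) (A B S T : H -> H) (t : R).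

(** Complex coefficients allow a real polynomial to be split into linear factors. *)
Definition hop (p : {poly R[i]}) A x : H := \sum_(i < size p) p`_i *: iter i A x.

Lemma hop_widen n (p : {poly R[i]}) A x : (size p <= n)%N ->
  hop p A x = \sum_(i < n) p`_i *: iter i A x.
Proof.
move=> pn; rewrite /hop -(big_mkord xpredT (fun i => p`_i *: iter i A x)).
rewrite -[RHS](big_mkord xpredT (fun i => p`_i *: iter i A x)).
rewrite (big_cat_nat_idem (n := size p) _ _ pn)//=; last exact: addr0.
rewrite [X in _ = _ + X]big_nat [X in _ = _ + X]big1 ?addr0// => i /andP[pi _].
by rewrite nth_default// scale0r.
Qed.

Lemma hopD p q A x : hop (p + q) A x = hop p A x + hop q A x.
Proof.
pose n := maxn (size p) (size q).
rewrite (@hop_widen n) ?size_polyD// (@hop_widen n p) ?leq_maxl//.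
rewrite (@hop_widen n q) ?leq_maxr// -big_split /=.
by apply: eq_bigr => i _; rewrite coefD scalerDl.
Qed.

Lemma hop0 A x : hop 0 A x = 0.
Proof. by rewrite /hop size_poly0 big_ord0. Qed.

Lemma hopC a A x : hop a%:P A x = a *: x.
Proof. by rewrite (@hop_widen 1) ?size_polyC_leq1// big_ord1 coefC. Qed.

Lemma hopMX p A x : hop (p * 'X) A x = hop p A (A x).
Proof.
rewrite (@hop_widen (size p).+1); last first.
  by rewrite (leq_trans (size_polyMleq _ _))// size_polyX addn2.
rewrite big_ord_recl /= coefMX /= scale0r add0r; apply: eq_bigr => i _.
by rewrite coefMX -iterSr.
Qed.

Lemma hopXsubC a A x : hop ('X - a%:P) A x = A x - a *: x.
Proof.
by rewrite -polyCN hopD hopC -['X]mul1r hopMX hopC scale1r scaleNr.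
Qed.

Lemma hopZ a p A x : hop (a *: p) A x = a *: hop p A x.
Proof.
rewrite (@hop_widen (size p)) ?size_scale_leq// /hop scaler_sumr.
by apply: eq_bigr => i _; rewrite coefZ scalerA.
Qed.

Lemma bounded_hop p A : bounded_op A -> bounded_op (hop p A).
Proof.
move=> bA; elim/poly_ind: p => [|p c IHp].
  have := bounded_opZ 0 (bounded_op_id H); congr bounded_op.
  by apply/funext => x; rewrite hop0 scale0r.
have := bounded_opD (bounded_op_comp IHp bA) (bounded_opZ c (bounded_op_id H)).
by congr bounded_op; apply/funext => x; rewrite hopD hopMX hopC.
Qed.

Lemma hop_comm p A x : linear A -> hop p A (A x) = A (hop p A x).
Proof.
move=> lA; elim/poly_ind: p x => [|p c IHp] x.
  by rewrite !hop0 lin0.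
by rewrite !hopD !hopMX !hopC (linD lA) (linZ lA) IHp.
Qed.

Lemma hopM p q A x : linear A -> hop (p * q) A x = hop p A (hop q A x).
Proof.
move=> lA; elim/poly_ind: p x => [|p c IHp] x; first by rewrite mul0r !hop0.
rewrite mulrDl mulrAC mul_polyC !hopD !hopMX hopZ hopC.
by rewrite IHp hop_comm.
Qed.

Lemma horner_opE (p : {poly R}) A x :
  horner_op p A x = hop (map_poly (real_complex R) p) A x.
Proof.
rewrite /horner_op /hop size_map_poly; apply: eq_bigr => i _.
by rewrite coef_map.
Qed.

Lemma horner_opD (p q : {poly R}) A x :
  horner_op (p + q) A x = horner_op p A x + horner_op q A x.
Proof. by rewrite !horner_opE rmorphD hopD. Qed.

Lemma horner_opC (c : R) A x : horner_op c%:P A x = c%:C *: x.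
Proof. by rewrite horner_opE map_polyC hopC. Qed.

Lemma horner_opZ (c : R) (p : {poly R}) A x :
  horner_op (c *: p) A x = c%:C *: horner_op p A x.
Proof. by rewrite !horner_opE map_polyZ hopZ. Qed.

Lemma horner_opN (p : {poly R}) A x : horner_op (- p) A x = - horner_op p A x.
Proof. by rewrite -scaleN1r horner_opZ rmorphN rmorph1 scaleN1r. Qed.

Lemma horner_opMX (p : {poly R}) A x : horner_op (p * 'X) A x = horner_op p A (A x).
Proof. by rewrite !horner_opE rmorphM /= map_polyX hopMX. Qed.

Lemma horner_opX A x : horner_op 'X A x = A x.
Proof. by rewrite -['X]mul1r horner_opMX horner_opC scale1r. Qed.

Lemma horner_opM (p q : {poly R}) A x : linear A ->
  horner_op (p * q) A x = horner_op p A (horner_op q A x).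
Proof. by move=> lA; rewrite !horner_opE rmorphM /= hopM. Qed.

Lemma horner_op_comm (p : {poly R}) A x : linear A ->
  horner_op p A (A x) = A (horner_op p A x).
Proof. by move=> lA; rewrite !horner_opE hop_comm. Qed.

Lemma bounded_horner_op (p : {poly R}) A : bounded_op A -> bounded_op (horner_op p A).
Proof.
move=> bA; have := bounded_hop (map_poly (real_complex R) p) bA; congr bounded_op.
by apply/funext => x; rewrite horner_opE.
Qed.

Lemma horner_op_comp_sqr (p : {poly R}) A x : linear A ->
  horner_op (p \Po 'X^2) A x = horner_op p (A \o A) x.
Proof.
move=> lA; elim/poly_ind: p x => [|p c IHp] x.
  by rewrite comp_poly0 !horner_opC !scale0r.
rewrite comp_polyD comp_polyM comp_polyX comp_polyC !horner_opD !horner_opC.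
by rewrite horner_opMX expr2 mulrA !horner_opMX IHp.
Qed.

Lemma horner_op_intertwine (p : {poly R}) A B T :
  linear T -> (forall x, B (T x) = T (A x)) ->
  forall x, horner_op p B (T x) = T (horner_op p A x).
Proof.
move=> lT BT; elim/poly_ind: p => [|p c IHp] x.
  by rewrite !horner_opC !scale0r (lin0 lT).
by rewrite !horner_opD !horner_opMX !horner_opC BT IHp (linD lT) (linZ lT).
Qed.

Definition selfadj A := forall x y, inner (A x) y = inner x (A y).
(** The approximate point spectrum of [A] consists of the [t] for which [A - t] fails this. *)
Definition bounded_below B := exists c : R, 0 < c /\ forall x, c * nrm x <= nrm (B x).

Lemma selfadj_rip A x y : selfadj A -> rip (A x) y = rip x (A y).
Proof. by rewrite /rip => ->. Qed.

Lemma selfadj_Im A x : selfadj A -> Im (inner (A x) x) = 0.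
Proof.
move=> sA; have := sA x x; rewrite [RHS]innerC.
by case: (inner _ _) => a b [] /= hb; lra.
Qed.

(** Polarisation: the form is real at [x + y] and at [x + 'i y], which matches the imaginary and
    then the real parts. *)
Lemma positive_selfadj A : positive_op A -> selfadj A.
Proof.
move=> [[lA _] A0] x y; have imA (z : H) : Im (inner (A z) z) = 0
  by rewrite (ge0_ReE (A0 z)).
have := imA (x + y); have := imA (x + 'i%C *: y).
rewrite !(linD lA) !(linZ lA) !(innerDl, innerDr, innerZl, innerZr).
rewrite [inner x (A y)]innerC.
move: (imA x) (imA y).
case: (inner (A x) x) => ? ? /= ->; case: (inner (A y) y) => ? ? /= ->.
case: (inner (A x) y) => a b; case: (inner (A y) x) => c d /= h1 h2.
by congr (_ +i* _)%C; lra.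
Qed.

Lemma selfadj_horner_op (p : {poly R}) A : linear A -> selfadj A ->
  selfadj (horner_op p A).
Proof.
move=> lA sA; elim/poly_ind: p => [|p c IHp] x y.
  by rewrite !horner_opC !scale0r linear0l linear0r.
rewrite !horner_opD !horner_opMX !horner_opC innerDl innerDr IHp sA.
rewrite -horner_op_comm// innerZl innerZr.
by congr (_ + _ * _); apply/esym/conjc_real.
Qed.

(** Since [inner (A x) x] is real, pairing [A x - a x] with ['i x] isolates [Im a * nrm x ^ 2];
    Cauchy-Schwarz does the rest. *)
Lemma bounded_below_nonreal A a : selfadj A -> Im a != 0 ->
  bounded_below (fun x => A x - a *: x).
Proof.
move=> sA a0; exists `|Im a|; split=> [|x]; first by rewrite normr_gt0.
have [->|x0] := eqVneq (nrm x) 0; first by rewrite mulr0 nrm_ge0.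
have x1 : 0 < nrm x by rewrite lt_def x0 nrm_ge0.
rewrite -(ler_pM2r x1).
have := rip_norm_CauchySchwarz (A x - a *: x) ('i%C *: x).
have -> : nrm ('i%C *: x) = nrm x.
  by rewrite nrmZ Re_norm /= expr0n expr1n add0r sqrtr1 mul1r.
suff -> : rip (A x - a *: x) ('i%C *: x) = - (Im a * nrm x ^+ 2).
  by rewrite normrN normrM (ger0_norm (sqr_ge0 _)) expr2 mulrA.
rewrite /rip innerZr innerDl innerNl innerZl inner_nrm.
have := selfadj_Im x sA; case: (inner (A x) x) => u v /= ->.
by case: a {a0} => b c /=; ring.
Qed.

(** Induction on the linear factors of [g], lower bounds being multiplied. Self-adjointness takes
    care of the nonreal roots. *)
Lemma bounded_below_hop A (g : {poly R[i]}) : bounded_op A -> selfadj A -> g != 0 ->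
  (forall t, root g t%:C -> bounded_below (fun x => A x - t%:C *: x)) ->
  bounded_below (hop g A).
Proof.
move=> bA sA g0; have [r def_g] := closed_field_poly_normal g.
have lc0 : lead_coef g != 0 by rewrite lead_coef_eq0.
have lA := bA.1.
move=> hroot; have {hroot} hr z : z \in r -> bounded_below (fun x => A x - z *: x).
  move=> zr; have [z0|] := eqVneq (Im z) 0; last exact: bounded_below_nonreal.
  have -> : z = (Re z)%:C by case: z z0 {zr} => ? ? /= ->.
  apply: hroot; rewrite -[_%:C]/(Re z +i* 0)%C -z0 def_g rootZ//.
  by case: (z) zr => ? ? /=; rewrite root_prod_XsubC.
suff [c [c0 hc]] : bounded_below (hop (\prod_(z <- r) ('X - z%:P)) A).
  exists (Re `|lead_coef g| * c); split=> [|x].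
    by rewrite mulr_gt0// lt_def Re_norm_ge0 andbT; apply: contra_neq lc0 => e0;
       apply/normr0_eq0; rewrite norm_Re e0.
  by rewrite def_g hopZ nrmZ -def_g -mulrA ler_wpM2l// Re_norm_ge0.
elim: r hr {def_g} => [|z r IHr] hr.
  exists 1; split=> // x; by rewrite big_nil hopC scale1r mul1r.
have [c [c0 hc]] := hr z (mem_head _ _).
have [d [d0 hd]] := IHr (fun w wr => hr w (@mem_behead _ (z :: r) w wr)).
exists (c * d); split=> [|x]; first exact: mulr_gt0.
rewrite big_cons hopM// hopXsubC (le_trans _ (hc _))// -mulrA.
by rewrite ler_wpM2l// ltW.
Qed.

(* Test [<C(x - s C x), x - s C x> >= 0] at [s = 1/K]. *)
Lemma nrm_sqr_le_form C K x : linear C -> selfadj C -> 0 < K ->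
  (forall y, nrm (C y) <= K * nrm y) -> (forall y, 0 <= rip (C y) y) ->
  nrm (C x) ^+ 2 <= K * rip (C x) x.
Proof.
move=> lC sC K0 hK C0.
have := C0 (x - K^-1%:C *: C x).
rewrite (linB lC) (linZ lC) !ripE (selfadj_rip (C x) x sC) -!ripxx.
have h : rip (C (C x)) (C x) <= K * rip (C x) (C x).
  rewrite (le_trans (rip_CauchySchwarz _ _))// ripxx expr2 mulrA.
  by rewrite ler_wpM2r ?nrm_ge0.
have {h} : K^-1 * (K^-1 * rip (C (C x)) (C x)) <= K^-1 * rip (C x) (C x).
  by rewrite ler_wpM2l ?invr_ge0 ?(ltW K0)// ler_pdivrMl.
move=> h1 h2; rewrite -ler_pdivrMl//; lra.
Qed.

(* If the bottom [m] of the numerical range of [q(A)] were negative, [q - m] would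
   not vanish on the approximate point spectrum, so [q(A) - m >= 0] would be bounded
   below, pushing the numerical range away from [m]. *)
Lemma horner_op_ge0_nonconst A (q : {poly R}) : bounded_op A -> selfadj A ->
  (1 < size q)%N ->
  (forall t, ~ bounded_below (fun x => A x - t%:C *: x) -> 0 <= q.[t]) ->
  forall x, 0 <= rip (horner_op q A x) x.
Proof.
move=> bA sA q_nc hq x0; rewrite leNgt; apply/negP => qx0.
have lA := bA.1.
have /bounded_opP[lq [K [K0 hK]]] := bounded_horner_op q bA.
have sq := selfadj_horner_op q lA sA.
pose N := [set rip (horner_op q A x) x | x in [set x | nrm x = 1]]%classic.
have x0_neq0 : x0 != 0 by apply/eqP => x00; move: qx0;
  rewrite x00 (lin0 lq) /rip linear0l ltxx.
have nx0 : 0 < nrm x0.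
  by rewrite lt_def nrm_ge0 andbT; apply: contra_neq x0_neq0 => /nrm_eq0.
pose e := (nrm x0)^-1%:C *: x0.
have e1 : nrm e = 1 by exact: nrm_scale1.
have infN : has_inf N.
  split; first by exists (rip (horner_op q A e) e), e.
  exists (- K) => _ [x /= x1 <-]; rewrite lerNl -ripNl.
  rewrite (le_trans (rip_CauchySchwarz _ _))// nrmN x1 mulr1.
  by rewrite -[leRHS]mulr1 -x1.
pose m := inf N.
have m0 : m < 0.
  apply: (@le_lt_trans _ _ (rip (horner_op q A e) e)).
    by apply: ge_inf; [exact: infN.2 | exists e].
  rewrite /e (linZ lq) !ripE pmulr_rlt0 ?invr_gt0// pmulr_rlt0 ?invr_gt0//.
have hm x : m * nrm x ^+ 2 <= rip (horner_op q A x) x.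
  have [->|xn0] := eqVneq x 0.
    by rewrite nrm0 expr0n mulr0 (lin0 lq) /rip linear0l.
  have nx : 0 < nrm x.
    by rewrite lt_def nrm_ge0 andbT; apply: contra_neq xn0 => /nrm_eq0.
  have : m <= rip (horner_op q A ((nrm x)^-1%:C *: x)) ((nrm x)^-1%:C *: x).
    apply: ge_inf; first exact: infN.2.
    by exists ((nrm x)^-1%:C *: x) => //=; exact: nrm_scale1.
  by rewrite (linZ lq) !ripE mulrA -invfM -expr2 ler_pdivlMl ?exprn_gt0// mulrC.
pose g := q - m%:P.
have gE x : horner_op g A x = horner_op q A x - m%:C *: x.
  by rewrite horner_opD -polyCN horner_opC rmorphN scaleNr.
have /bounded_opP[lg [L [L0 hL]]] := bounded_horner_op g bA.
have sg := selfadj_horner_op g lA sA.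
(* At a real root [t] of [g], [q] has the value [m < 0], so [hq] forces [A - t] to be bounded below;
   [g] is nonzero because [q] is not constant. *)
have [c [c0 hc]] : bounded_below (horner_op g A).
  have [c [c0 hc]] : bounded_below (hop (map_poly (real_complex R) g) A).
    apply: bounded_below_hop => //.
      rewrite map_poly_eq0 subr_eq0; apply: contraTneq q_nc => ->.
      by rewrite -leqNgt size_polyC_leq1.
    move=> t; rewrite fmorph_root /root hornerD hornerN hornerC subr_eq0 => /eqP qt.
    by have [//|/hq] := pselect (bounded_below (fun x => A x - t%:C *: x)); rewrite qt leNgt m0.
  by exists c; split=> // x; rewrite horner_opE.
(* By [hm] the form of [g(A)] is nonnegative, so it dominates [nrm (g(A) x) ^ 2 / L], hence
   [c ^ 2 / L * nrm x ^ 2]. *)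
have low x : m * nrm x ^+ 2 + c ^+ 2 / L * nrm x ^+ 2 <= rip (horner_op q A x) x.
  have := @nrm_sqr_le_form _ L x lg sg L0 hL; rewrite gE.
  have := hc x; rewrite gE => hcx hlow.
  have {}hlow := le_trans _ (hlow _).
  have : (c * nrm x) ^+ 2 <= L * rip (horner_op q A x - m%:C *: x) x.
    apply: hlow => [|y]; first by rewrite ler_pXn2r ?nnegrE ?mulr_ge0 ?nrm_ge0 ?(ltW c0).
    by rewrite gE !ripE ripxx subr_ge0.
  rewrite exprMn !ripE ripxx -ler_pdivrMl// mulrA (mulrC L^-1).
  lra.
have cL : 0 < c ^+ 2 / L by rewrite divr_gt0// exprn_gt0.
suff : m + c ^+ 2 / L <= m by rewrite gerDl leNgt cL.
apply: lb_le_inf; first exact: infN.1.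
by move=> _ [x /= x1 <-]; rewrite (le_trans _ (low x))// x1 expr1n !mulr1.
Qed.

(** For a constant [q] the content is that the approximate point spectrum is nonempty when [H] is
    nontrivial. A negative constant would make it empty, and every nonconstant polynomial of [A]
    would then be nonnegative. *)
Lemma horner_op_ge0 A (q : {poly R}) : bounded_op A -> selfadj A ->
  (forall t, ~ bounded_below (fun x => A x - t%:C *: x) -> 0 <= q.[t]) ->
  forall x, 0 <= rip (horner_op q A x) x.
Proof.
move=> bA sA hq x; have [q_c|] := leqP (size q) 1; last first.
  by move=> q_nc; apply: horner_op_ge0_nonconst.
have [c qE] : exists c, q = c%:P by exists q`_0; apply: size1_polyC.
rewrite qE horner_opC ripZl ripxx.
have [c0|c0] := leP 0 c; first by rewrite mulr_ge0 ?sqr_ge0.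
have [->|x0] := eqVneq x 0; first by rewrite nrm0 expr0n mulr0.
have nx : 0 < nrm x ^+ 2.
  by rewrite exprn_gt0// lt_def nrm_ge0 andbT; apply: contra_neq x0 => /nrm_eq0.
(* One more than the Rayleigh quotient: the form of [A - d] at [x] is [- nrm x ^ 2], a
   contradiction. *)
pose d := rip (A x) x / nrm x ^+ 2 + 1.
suff : 0 <= rip (horner_op ('X - d%:P) A x) x.
  rewrite horner_opE rmorphB /= map_polyX map_polyC hopXsubC !ripE ripxx.
  by rewrite /d mulrDl divfK ?gt_eqF// mul1r opprD addNKr oppr_ge0 leNgt nx.
apply: horner_op_ge0_nonconst => //; first by rewrite size_XsubC.
by move=> t /hq; rewrite qE hornerC leNgt c0.
Qed.

Section PositiveOperator.
Variables (A : H -> H) (M : R).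
Hypotheses (bA : bounded_op A) (sA : selfadj A) (M0 : 0 <= M).
Hypotheses (A_ge0 : forall x, 0 <= rip (A x) x).
Hypotheses (A_leM : forall x, rip (A x) x <= M * nrm x ^+ 2).

Lemma bounded_below_form B (c : R) : 0 < c ->
  (forall x, c * nrm x ^+ 2 <= `|rip (B x) x|) -> bounded_below B.
Proof.
move=> c0 hc; exists c; split=> // x; have [->|x0] := eqVneq (nrm x) 0.
  by rewrite mulr0 nrm_ge0.
have nx : 0 < nrm x by rewrite lt_def x0 nrm_ge0.
rewrite -(ler_pM2r nx) -mulrA -expr2 (le_trans (hc x))//.
exact: rip_norm_CauchySchwarz.
Qed.

Lemma bounded_below_outside t : ~~ (0 <= t <= M) ->
  bounded_below (fun x => A x - t%:C *: x).
Proof.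
rewrite negb_and -!ltNge => /orP[t0|tM].
  apply: (@bounded_below_form _ (- t)) => [|x]; first lra.
  by rewrite !ripE ripxx (le_trans _ (ler_norm _))// mulNr lerDr.
apply: (@bounded_below_form _ (t - M)) => [|x]; first lra.
rewrite -normrN !ripE ripxx (le_trans _ (ler_norm _))//.
by have := A_leM x; lra.
Qed.

Lemma horner_op_itv_ge0 (q : {poly R}) : (forall t : R, 0 <= t <= M -> 0 <= q.[t]) ->
  forall x, 0 <= rip (horner_op q A x) x.
Proof.
move=> hq; apply: horner_op_ge0 => // t ht; apply: hq.
by apply: contra_notT ht; apply: bounded_below_outside.
Qed.

(** Positivity of [e ^ 2 - p ^ 2] on [[0, M]], because the form of [p(A) ^ 2] at [x] is
    [nrm (p(A) x) ^ 2]. *)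
Lemma horner_op_itv_norm (p : {poly R}) (e : R) : 0 <= e ->
  (forall t : R, 0 <= t <= M -> `|p.[t]| <= e) ->
  forall x, nrm (horner_op p A x) <= e * nrm x.
Proof.
move=> e0 hp x; rewrite -(@ler_pXn2r _ 2) ?nnegrE ?mulr_ge0 ?nrm_ge0//.
suff : 0 <= rip (horner_op ((e ^+ 2)%:P - p * p) A x) x.
  rewrite horner_opD horner_opC horner_opN (horner_opM _ _ _ bA.1) !ripE ripxx.
  rewrite (selfadj_rip _ _ (selfadj_horner_op p bA.1 sA)) ripxx exprMn.
  by rewrite subr_ge0.
apply: horner_op_itv_ge0 => t /hp pt; rewrite !hornerE subr_ge0 -expr2.
by rewrite -[leLHS]real_normK ?num_real// ler_pXn2r ?nnegrE.
Qed.

End PositiveOperator.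

End PolynomialCalculus.

(** * Weierstrass approximation by Bernstein polynomials *)

Section Weierstrass.
Variable R : realType.
Implicit Types (f : R -> R) (g h : nat -> R) (x c : R).

(* The Bernstein polynomial [\sum_k g k * 'C(n, k) x^k (1 - x)^(n - k)], i.e. the
   expectation of [g] under the binomial law, by conditioning on the first trial. *)
Fixpoint bernstein n g : {poly R} :=
  if n is m.+1 then (1 - 'X) * bernstein m g + 'X * bernstein m (fun k => g k.+1)
  else (g 0%N)%:P.

Lemma bernsteinS n g x : (bernstein n.+1 g).[x] =
  (1 - x) * (bernstein n g).[x] + x * (bernstein n (fun k => g k.+1)).[x].
Proof. by rewrite /= !hornerE. Qed.

Lemma ler_bernstein n g h x : 0 <= x <= 1 ->
  (forall k, (k <= n)%N -> g k <= h k) -> (bernstein n g).[x] <= (bernstein n h).[x].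
Proof.
move=> /andP[x0 x1]; elim: n g h => [|n IHn] g h gh.
  by rewrite /= !hornerC gh.
rewrite !bernsteinS lerD// ler_wpM2l ?subr_ge0//; apply: IHn => k kn; apply: gh => //.
exact: leqW.
Qed.

Lemma bernstein_affine n g x a b :
  (bernstein n (fun k => a + b * g k)).[x] = a + b * (bernstein n g).[x].
Proof.
elim: n g => [|n IHn] g; first by rewrite /= !hornerC.
by rewrite !bernsteinS !IHn; ring.
Qed.

(** Squared bias plus binomial variance. A success in the first trial replaces [c] by [c - 1], so
    the induction runs over all [c]. *)
Lemma bernstein_variance n x c :
  (bernstein n (fun k => (k%:R - c) ^+ 2)).[x] = (n%:R * x - c) ^+ 2 + n%:R * x * (1 - x).
Proof.
elim: n c => [|n IHn] c; first by rewrite /= hornerC; ring.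
rewrite bernsteinS IHn.
have -> : (fun k => (k.+1%:R - c) ^+ 2) = (fun k => (k%:R - (c - 1)) ^+ 2).
  by apply/funext => k; rewrite -natr1; ring.
by rewrite IHn -natr1; ring.
Qed.

(** The bound [K] is carried along explicitly because Weierstrass approximation and products in the
    calculus use it. *)
Definition unif_cont_on (M : R) f :=
  (exists K : R, forall t : R, 0 <= t <= M -> `|f t| <= K) /\
  (forall e : R, 0 < e -> exists d : R, 0 < d /\ forall s t : R, 0 <= s <= M -> 0 <= t <= M ->
     `|s - t| <= d -> `|f s - f t| <= e).

(** Chebyshev's argument: the deviation of [f] at [k / n] from [f x] is at most
    [e / 2 + C (k / n - x) ^ 2]. Taking expectations leaves [e / 2 + C x (1 - x) / n]. *)
Lemma Weierstrass01 f : unif_cont_on 1 f -> forall e : R, 0 < e ->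
  exists p : {poly R}, forall x : R, 0 <= x <= 1 -> `|p.[x] - f x| <= e.
Proof.
move=> [[K hK] ucf] e e0; have [d [d0 hd]] := ucf _ (divr_gt0 e0 (ltr0n R 2)).
have K0 : 0 <= K by apply: le_trans (normr_ge0 _) (hK 0 _); rewrite lexx ler01.
(* Chosen so that [C u ^ 2] exceeds the trivial bound [2 K] as soon as [u] is farther than [d] from
   0. *)
pose C := 2 * K / d ^+ 2.
have C0 : 0 <= C by rewrite /C divr_ge0 ?sqr_ge0 ?mulr_ge0.
pose n := (Num.truncn (2 * C / e)).+1.
have n0 : 0 < n%:R :> R by rewrite ltr0n.
have nC : C / n%:R <= e / 2.
  have : 2 * C / e < n%:R by apply: truncnS_gt.
  rewrite ltr_pdivrMr// ler_pdivrMr// => h; lra.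
clearbody n; exists (bernstein n (fun k => f (k%:R / n%:R))) => x x01.
have pt k : (k <= n)%N ->
    `|f (k%:R / n%:R) - f x| <= e / 2 + C / n%:R ^+ 2 * (k%:R - n%:R * x) ^+ 2.
  move=> kn; have kn01 : 0 <= (k%:R / n%:R : R) <= 1.
    apply/andP; split; first by rewrite divr_ge0.
    by rewrite ler_pdivrMr// mul1r ler_nat.
  have -> : C / n%:R ^+ 2 * (k%:R - n%:R * x) ^+ 2 = C * (k%:R / n%:R - x) ^+ 2.
    by field; rewrite gt_eqF.
  have [near|far] := leP `|k%:R / n%:R - x| d.
    by rewrite (le_trans (hd _ _ kn01 x01 near))// lerDl mulr_ge0// sqr_ge0.
  have : 2 * K <= C * (k%:R / n%:R - x) ^+ 2.
    rewrite /C mulrAC ler_pdivlMr ?exprn_gt0// ler_wpM2l ?mulr_ge0//.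
    rewrite -[leRHS]real_normK ?num_real//.
    by rewrite ler_pXn2r ?nnegrE ?(ltW d0)// ltW.
  have := ler_normB (f (k%:R / n%:R)) (f x); have := hK _ kn01; have := hK _ x01.
  by move: e0; lra.
(* [b] is a sign: -1 for the lower envelope of [f], 1 for the upper one. *)
have errE b : (bernstein n (fun k => (f x + b * (e / 2)) +
      b * (C / n%:R ^+ 2) * (k%:R - n%:R * x) ^+ 2)).[x] =
    f x + b * (e / 2 + C / n%:R * (x * (1 - x))).
  by rewrite bernstein_affine bernstein_variance; field; rewrite gt_eqF.
have x1 : x * (1 - x) <= 1 by move: x01 => /andP[? ?]; nra.
have err : e / 2 + C / n%:R * (x * (1 - x)) <= e.
  have : C / n%:R * (x * (1 - x)) <= C / n%:R.
    by rewrite ler_piMr// divr_ge0// ltW.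
  lra.
rewrite ler_norml; apply/andP; split.
  have : (bernstein n (fun k => (f x + -1 * (e / 2)) +
      -1 * (C / n%:R ^+ 2) * (k%:R - n%:R * x) ^+ 2)).[x] <=
      (bernstein n (fun k => f (k%:R / n%:R))).[x].
    apply: ler_bernstein => // k /pt; rewrite ler_norml => /andP[+ _]; lra.
  by rewrite errE; lra.
have : (bernstein n (fun k => f (k%:R / n%:R))).[x] <=
    (bernstein n (fun k => (f x + 1 * (e / 2)) +
      1 * (C / n%:R ^+ 2) * (k%:R - n%:R * x) ^+ 2)).[x].
  apply: ler_bernstein => // k /pt; rewrite ler_norml => /andP[_]; lra.
by rewrite errE; lra.
Qed.

Lemma Weierstrass (M : R) f : 0 < M -> unif_cont_on M f -> forall e : R, 0 < e ->
  exists p : {poly R}, forall x : R, 0 <= x <= M -> `|p.[x] - f x| <= e.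
Proof.
move=> M0 [[K hK] ucf] e e0.
have scaled t : 0 <= t <= 1 -> 0 <= M * t <= M.
  by move=> /andP[t0 t1]; rewrite mulr_ge0 ?(ltW M0)//= ler_piMr ?(ltW M0).
have [|p hp] := @Weierstrass01 (fun t => f (M * t)) _ e e0.
  split; first by exists K => t /scaled; apply: hK.
  move=> e1 /ucf[d [d0 hd]]; exists (d / M); split=> [|s t /scaled s1 /scaled t1 st].
    exact: divr_gt0.
  by apply: hd => //; rewrite -mulrBr normrM gtr0_norm// mulrC -ler_pdivlMr.
exists (p \Po (M^-1 *: 'X)) => x /andP[x0 xM]; rewrite horner_comp !hornerE.
have := hp (M^-1 * x); rewrite mulrA divff ?gt_eqF// mul1r; apply.
by rewrite mulr_ge0 ?invr_ge0 ?(ltW M0)//= ler_pdivrMl// mulr1.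
Qed.

Lemma unif_cont_on_lipschitz (M L : R) f : 0 <= M -> 0 <= L ->
  (forall s t : R, 0 <= s <= M -> 0 <= t <= M -> `|f s - f t| <= L * `|s - t|) ->
  unif_cont_on M f.
Proof.
move=> M0 L0 hL; split.
  exists (`|f 0| + L * M) => t t0M; have := hL t 0 t0M.
  rewrite lexx M0 subr0 => /(_ isT); move/andP: (t0M) => [t0 tM].
  rewrite (ger0_norm t0) => h; have := ler_wpM2l L0 tM.
  by have := ler_normD (f t - f 0) (f 0); rewrite subrK; lra.
move=> e e0; exists (e / (L + 1)); have L1 : 0 < L + 1 by lra.
split=> [|s t s0 t0 st]; first exact: divr_gt0.
rewrite (le_trans (hL s t s0 t0))// (le_trans (ler_wpM2l L0 st))//.
by rewrite mulrA ler_pdivrMr// mulrDr mulr1 (mulrC L) lerDl ltW.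
Qed.

(** The square of the difference of two roots is at most the difference of the arguments, whence the
    modulus [e ^ 2]. *)
Lemma unif_cont_on_sqrt (M : R) : 0 <= M -> unif_cont_on M Num.sqrt.
Proof.
move=> M0; split.
  by exists (Num.sqrt M) => t /andP[t0 tM]; rewrite ger0_norm ?sqrtr_ge0// ler_sqrt.
have sub_sqrt (s t : R) : 0 <= s -> 0 <= t -> s <= t ->
    `|Num.sqrt s - Num.sqrt t| ^+ 2 <= t - s.
  move=> s0 t0 st; have := sqr_sqrtr s0; have := sqr_sqrtr t0.
  have := sqrtr_ge0 s; rewrite -(ler_sqrt _ t0) in st; move: st.
  rewrite real_normK ?num_real//; set a := Num.sqrt s; set b := Num.sqrt t.
  by move=> ab a0 <- <-; nra.
move=> e e0; exists (e ^+ 2); split=> [|s t /andP[s0 _] /andP[t0 _]].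
  exact: exprn_gt0.
wlog st : s t s0 t0 / s <= t.
  move=> hw h; have [st|/ltW ts] := leP s t; first exact: hw.
  by rewrite distrC; apply: hw => //; rewrite distrC.
rewrite distrC ger0_norm ?subr_ge0// => h.
by have := le_trans (sub_sqrt s t s0 t0 st) h; rewrite ler_pXn2r ?nnegrE ?(ltW e0).
Qed.

Lemma unif_cont_on_inv (M t : R) : 0 <= M -> ~~ (0 <= t <= M) ->
  unif_cont_on M (fun s => (s - t)^-1).
Proof.
(* [c] is the distance from [t] to [[0, M]]. *)
move=> M0 tM; pose c := if t < 0 then - t else t - M.
have c0 : 0 < c.
  rewrite /c; have [t0|t0] := ltP t 0; first by rewrite oppr_gt0.
  by move: tM; rewrite t0 /= -ltNge subr_gt0.
have hc s : 0 <= s <= M -> c <= `|s - t|.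
  move=> /andP[s0 sM]; rewrite /c; have [t0|t0] := ltP t 0.
    by rewrite (le_trans _ (ler_norm _))//; lra.
  by rewrite distrC (le_trans _ (ler_norm _))//; lra.
apply: (@unif_cont_on_lipschitz M (c^-1 * c^-1)) => //.
  by rewrite mulr_ge0 ?invr_ge0 ?ltW.
move=> s r /hc hs /hc hr.
have s0 : s - t != 0 by rewrite -normr_gt0 (lt_le_trans c0).
have r0 : r - t != 0 by rewrite -normr_gt0 (lt_le_trans c0).
have -> : (s - t)^-1 - (r - t)^-1 = (s - t)^-1 * (r - t)^-1 * (r - s).
  by field; rewrite s0 r0.
rewrite !normrM distrC ler_wpM2r// !normfV.
by rewrite ler_pM ?invr_ge0// lef_pV2// posrE ?normr_gt0.
Qed.

End Weierstrass.

(** * Filter convergence in terms of epsilon *)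

Section UniformConvergence.
Variable R : realType.

Lemma uniform_cvg_seqP (D : set R) (u : nat -> R -> R) (f : R -> R) :
  {uniform D, u @ \oo --> f}%classic <->
  (forall e : R, 0 < e -> exists N : nat, forall n, (N <= n)%N ->
     forall t, D t -> `|u n t - f t| <= e).
Proof.
split=> [uf e e0|h P /uniform_nbhs[E [+ EP]]].
  have /uf[N _ hN] : nbhs (f : {uniform` D -> R})
      [set h | forall t, D t -> `|h t - f t| <= e]%classic.
    apply/uniform_nbhs; exists [set xy | ball xy.1 e xy.2]%classic; split.
      exact: entourage_ball (PosNum e0).
    by move=> h /= hh t /hh; rewrite -ball_normE /= distrC => /ltW.
  by exists N => n Nn; apply: hN.
rewrite -entourage_ballE => -[e /= e0 eE].
have [N hN] := h _ (divr_gt0 e0 (ltr0n R 2)).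
exists N => // n Nn; apply: EP => t Dt /=; apply: eE => /=.
rewrite -ball_normE /= distrC (le_lt_trans (hN n Nn t Dt))//.
by move: e0; rewrite ltr_pdivrMr//; lra.
Qed.

Lemma cvg0_seqP (u : nat -> R) :
  (u n @[n --> \oo] --> (0 : R))%classic <->
  (forall e : R, 0 < e -> exists N : nat, forall n, (N <= n)%N -> `|u n| <= e).
Proof.
split=> [/cvgrPdist_le h e e0|h]; last apply/cvgrPdist_le => e e0.
  by have [N _ hN] := h _ e0; exists N => n /hN; rewrite sub0r normrN.
by have [N hN] := h _ e0; exists N => // n /hN; rewrite sub0r normrN.
Qed.

End UniformConvergence.

(** * Continuous functional calculus on [[0, M]] *)

Section FunctionalCalculus.
Variables (R : realType) (H : hilbertType R) (A : H -> H) (M : R).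
Hypotheses (bA : bounded_op A) (sA : selfadj A) (M0 : 0 < M).
Hypotheses (A_ge0 : forall x, 0 <= rip (A x) x).
Hypotheses (A_leM : forall x, rip (A x) x <= M * nrm x ^+ 2).
Implicit Types (f g : R -> R) (B C : H -> H) (p q : {poly R}).

Definition approx_on p f (e : R) := forall t : R, 0 <= t <= M -> `|p.[t] - f t| <= e.

(* [B = f(A)], for [f] on [[0, M]]. *)
Definition fcalc f B := forall e : R, 0 < e ->
  exists p, approx_on p f e /\ forall x, nrm (horner_op p A x - B x) <= e * nrm x.

(** Passes from one good polynomial [q] to every [p] near [f]: [p - q] is at most [e + d] on
    [[0, M]], hence so is the norm of its value at [A], and [d] is arbitrary. *)
Lemma fcalc_approx f B p (e : R) : fcalc f B -> approx_on p f e ->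
  forall x, nrm (horner_op p A x - B x) <= e * nrm x.
Proof.
move=> fB pf x; apply: (@ler_small _ _ _ (2 * nrm x)) => [|d d0].
  by rewrite mulr_ge0 ?nrm_ge0.
have [q [qf qB]] := fB _ d0.
have e0 : 0 <= e.
  by apply: le_trans (normr_ge0 _) (pf 0 _); rewrite lexx ltW.
have pq : nrm (horner_op (p - q) A x) <= (e + d) * nrm x.
  apply: (@horner_op_itv_norm _ _ _ M bA sA) => // [|t ht]; first lra.
  rewrite !hornerE; have -> : p.[t] - q.[t] = (p.[t] - f t) - (q.[t] - f t) by ring.
  by rewrite (le_trans (ler_normB _ _))// lerD ?pf ?qf.
rewrite horner_opD horner_opN in pq.
have -> : horner_op p A x - B x =
    (horner_op p A x - horner_op q A x) + (horner_op q A x - B x).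
  by rewrite addrA subrK.
by rewrite (le_trans (nrmD _ _))//; have := qB x; lra.
Qed.

(** Turns identities between functions, such as a squared root or a reciprocal, into identities
    between operators. *)
Lemma fcalc_uniq f g B C : fcalc f B -> fcalc g C ->
  (forall t : R, 0 <= t <= M -> f t = g t) -> B =1 C.
Proof.
move=> fB gC fg x; apply: nrm_eq => e e0.
apply: (@ler_small _ _ _ (2 * nrm x)) => [|d d0].
  by rewrite mulr_ge0 ?nrm_ge0.
have [p [pf pB]] := fB _ d0.
have pg : approx_on p g d by move=> t ht; rewrite -fg// pf.
have := fcalc_approx gC pg x; have := pB x.
have -> : B x - C x = (horner_op p A x - C x) - (horner_op p A x - B x).
  by rewrite opprB [RHS]addrC addrA subrK.
by move=> h1 h2; rewrite (le_trans (nrmD _ _))// nrmN; lra.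
Qed.

Lemma fcalc_poly p : fcalc (fun t => p.[t]) (horner_op p A).
Proof.
move=> e e0; exists p; split=> [t _|x]; first by rewrite subrr normr0 ltW.
by rewrite subrr nrm0 mulr_ge0 ?nrm_ge0 ?ltW.
Qed.

Lemma fcalc_id : fcalc id A.
Proof.
have := fcalc_poly 'X; congr (fcalc _ _); apply/funext => ?.
  by rewrite hornerX.
by rewrite horner_opX.
Qed.

Lemma fcalc_linear f B : fcalc f B -> linear B.
Proof.
move=> fB a x y; apply: nrm_eq => e e0.
apply: (@ler_small _ _ _ (nrm (a *: x + y) + Re `|a| * nrm x + nrm y)) => [|d d0].
  by rewrite !addr_ge0 ?mulr_ge0 ?nrm_ge0 ?Re_norm_ge0.
have [p [_ pB]] := fB _ d0.
have [lp _] := bounded_horner_op p bA.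
have -> : B (a *: x + y) - (a *: B x + B y) =
  - (horner_op p A (a *: x + y) - B (a *: x + y)) +
    a *: (horner_op p A x - B x) + (horner_op p A y - B y).
  by rewrite lp scalerBr opprB -addrA [X in _ = _ + X]addrACA -opprD addrA subrK.
rewrite (le_trans (nrmD _ _))//.
have h1 := pB (a *: x + y); have h2 := ler_wpM2l (Re_norm_ge0 a) (pB x).
have h3 := pB y; have := nrmD (- (horner_op p A (a *: x + y) - B (a *: x + y)))
  (a *: (horner_op p A x - B x)).
rewrite nrmN nrmZ; lra.
Qed.

Lemma fcalc_bounded f B : fcalc f B -> bounded_op B.
Proof.
move=> fB; have [p [_ pB]] := fB 1 ltr01.
have /bounded_opP[lp [K [K0 hK]]] := bounded_horner_op p bA.
apply/bounded_opP; split; first exact: fcalc_linear fB.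
exists (K + 1); split=> [|x]; first by rewrite addr_gt0.
have -> : B x = horner_op p A x - (horner_op p A x - B x) by rewrite opprB addrC subrK.
by rewrite (le_trans (nrmD _ _))// nrmN mulrDl lerD.
Qed.

Lemma fcalc_mul f g B C (K : R) : fcalc f B -> fcalc g C -> 0 <= K ->
  (forall t : R, 0 <= t <= M -> `|f t| <= K) -> (forall t : R, 0 <= t <= M -> `|g t| <= K) ->
  fcalc (fun t => f t * g t) (B \o C).
Proof.
move=> fB gC K0 fK gK e e0.
have bB := fcalc_bounded fB; have /bounded_opP[lB [L [L0 hL]]] := bB.
(* For [d <= 1], [d W] dominates the scalar error [d (K + d) + K d] and the operator error
   [d (K + d) + L d]. *)
pose W := 2 * K + L + 2; have W1 : 0 < W by rewrite /W; lra.
pose d := Num.min 1 (e / W).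
have d0 : 0 < d by rewrite /d lt_min ltr01 divr_gt0.
have d1 : d <= 1 by rewrite /d ge_min lexx.
have dW : d * W <= e by rewrite -ler_pdivlMr// /d ge_min lexx orbT.
have [p [pf pB]] := fB _ d0; have [q [qg qC]] := gC _ d0.
have [lp _] := bounded_horner_op p bA.
have qK t : 0 <= t <= M -> `|q.[t]| <= K + d.
  move=> ht; rewrite -[q.[t]](subrK (g t)) (le_trans (ler_normD _ _))// addrC.
  by rewrite lerD ?gK ?qg.
exists (p * q); split=> [t ht|x].
  rewrite hornerM; have -> : p.[t] * q.[t] - f t * g t =
    (p.[t] - f t) * q.[t] + f t * (q.[t] - g t) by ring.
  rewrite (le_trans (ler_normD _ _))// !normrM (le_trans _ dW)//.
  have := ler_pM (normr_ge0 _) (normr_ge0 _) (pf t ht) (qK t ht).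
  have := ler_pM (normr_ge0 _) (normr_ge0 _) (fK t ht) (qg t ht).
  by rewrite /W; nra.
rewrite (horner_opM _ _ _ bA.1) /=.
have -> : horner_op p A (horner_op q A x) - B (C x) =
   (horner_op p A (horner_op q A x) - B (horner_op q A x)) +
   B (horner_op q A x - C x).
  by rewrite (linB lB) addrA subrK.
have h1 := pB (horner_op q A x); have h2 := hL (horner_op q A x - C x).
have h3 := ler_wpM2l (ltW L0) (qC x).
have h4 : nrm (horner_op q A x) <= (K + d) * nrm x.
  by apply: (@horner_op_itv_norm _ _ _ M) => //; lra.
have h5 := ler_wpM2l (ltW d0) h4; have h6 := ler_wpM2r (nrm_ge0 x) dW.
have h7 : 0 <= d * (K + 2 - d) * nrm x.
  by rewrite !mulr_ge0 ?nrm_ge0 ?(ltW d0)//; lra.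
rewrite (le_trans (nrmD _ _))//; move: h6 h7; rewrite /W; nra.
Qed.

Lemma fcalc_ge0 f B : fcalc f B -> (forall t : R, 0 <= t <= M -> 0 <= f t) ->
  forall x, 0 <= rip (B x) x.
Proof.
move=> fB f0 x; apply: (@ler_small _ _ _ (2 * nrm x ^+ 2)) => [|e e0].
  by rewrite mulr_ge0 ?sqr_ge0.
have [p [pf pB]] := fB _ e0.
(* Adding [e] makes the approximant nonnegative on [[0, M]]. *)
have : 0 <= rip (horner_op (p + e%:P) A x) x.
  apply: (@horner_op_itv_ge0 _ _ _ M) => // t ht; rewrite !hornerE.
  by have := pf t ht; have := f0 t ht; rewrite ler_norml => ? /andP[? _]; lra.
rewrite horner_opD horner_opC !ripE ripxx.
have := rip_CauchySchwarz (horner_op p A x - B x) x; rewrite !ripE.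
have := ler_wpM2r (nrm_ge0 x) (pB x); lra.
Qed.

Lemma fcalc_selfadj f B : fcalc f B -> selfadj B.
Proof.
move=> fB; have rB x y : rip (B x) y = rip x (B y).
  apply/eqP; rewrite -subr_eq0 -normr_le0.
  apply: (@ler_small _ _ _ (2 * nrm x * nrm y)) => [|e e0].
    by rewrite !mulr_ge0 ?nrm_ge0.
  have [p [_ pB]] := fB _ e0.
  have := selfadj_rip x y (selfadj_horner_op p bA.1 sA).
  have := rip_norm_CauchySchwarz (horner_op p A x - B x) y.
  have := rip_norm_CauchySchwarz x (horner_op p A y - B y).
  have := ler_wpM2r (nrm_ge0 y) (pB x); have := ler_wpM2l (nrm_ge0 x) (pB y).
  rewrite !ripE !ler_norml => h1 h2 /andP[h3 h4] /andP[h5 h6] h7.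
  by apply/andP; split; lra.
move=> x y; have := rB x y; have := rB ('i%C *: x) y.
rewrite (linZ (fcalc_linear fB)) /rip !innerZl.
by case: (inner (B x) y) (inner x (B y)) => [a b] [c d] /= h ->; congr (_ +i* _)%C; lra.
Qed.

Lemma fcalc_positive f B : fcalc f B -> (forall t : R, 0 <= t <= M -> 0 <= f t) ->
  positive_op B.
Proof.
move=> fB f0; split; first exact: fcalc_bounded fB.
move=> x; have := fcalc_ge0 fB f0 x; rewrite /rip.
have := selfadj_Im x (fcalc_selfadj fB).
by case: (inner (B x) x) => a b /= ->; rewrite lecE /= eqxx.
Qed.

(** Approximants of [f] are uniformly Cauchy on [[0, M]], so their values at [A] are Cauchy in norm.
    [B] is the pointwise limit; letting one index grow in the Cauchy estimate recovers the norm
    bound. *)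
Lemma fcalc_exists f : unif_cont_on M f -> exists B, fcalc f B.
Proof.
move=> ucf; have /choice[p_ hp] (n : nat) : exists p, approx_on p f n.+1%:R^-1.
  by apply: Weierstrass.
have pmn m n x : nrm (horner_op (p_ m) A x - horner_op (p_ n) A x) <=
    (m.+1%:R^-1 + n.+1%:R^-1) * nrm x.
  rewrite -horner_opN -horner_opD; apply: (@horner_op_itv_norm _ _ _ M) => //.
  move=> t ht; rewrite !hornerE.
  have -> : (p_ m).[t] - (p_ n).[t] = ((p_ m).[t] - f t) - ((p_ n).[t] - f t) by ring.
  by rewrite (le_trans (ler_normB _ _))// lerD ?hp.
have /choice[B hB] x : exists l, forall e : R, 0 < e ->
    exists N : nat, forall n, (N <= n)%N -> nrm (horner_op (p_ n) A x - l) <= e.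
  apply: nrm_complete => e e0; have x1 : 0 < nrm x + 1 by rewrite ltr_wpDl ?nrm_ge0.
  have d0 : 0 < e / 2 / (nrm x + 1) by rewrite !divr_gt0.
  have [N hN] := inv_nat_small d0; exists N => m n /hN hm /hN hn.
  have := ler_wpM2r (nrm_ge0 x) (lerD hm hn); have := pmn m n x.
  have : e / 2 / (nrm x + 1) * (nrm x + 1) = e / 2 by rewrite divfK ?gt_eqF.
  move: d0; move: (e / 2 / (nrm x + 1)) (m.+1%:R^-1) (n.+1%:R^-1) (nrm x) (nrm _).
  by move=> d i j nx D d0 h1 h2 h3; lra.
exists B => e e0; have [N hN] := inv_nat_small e0.
exists (p_ N); split=> [t ht|x]; first by rewrite (le_trans (hp _ _ ht))// hN.
apply: (@ler_small _ _ _ (nrm x + 1)) => [|d d0]; first by rewrite addr_ge0 ?nrm_ge0.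
have [N1 h1] := inv_nat_small d0; have [N2 h2] := hB x _ d0.
pose n := maxn N1 N2.
have -> : horner_op (p_ N) A x - B x =
  (horner_op (p_ N) A x - horner_op (p_ n) A x) + (horner_op (p_ n) A x - B x).
  by rewrite addrA subrK.
rewrite (le_trans (nrmD _ _))//.
have := h2 n (leq_maxr _ _); have := pmn N n x.
have := ler_wpM2r (nrm_ge0 x) (lerD (hN N (leqnn _)) (h1 n (leq_maxl _ _))).
move: (N.+1%:R^-1) (n.+1%:R^-1) (nrm (_ - _)) (nrm (_ - _)) (nrm x) d0.
by move=> i j D1 D2 nx d0 h3 h4 h5; lra.
Qed.

Lemma sqrt_exists : exists S, positive_op S /\ S \o S = A.
Proof.
have [S fS] := fcalc_exists (unif_cont_on_sqrt (ltW M0)).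
exists S; split; first by apply: (fcalc_positive fS) => t _; exact: sqrtr_ge0.
have [K hK] := (unif_cont_on_sqrt (ltW M0)).1.
have K0 : 0 <= K by apply: le_trans (normr_ge0 _) (hK 0 _); rewrite lexx ltW.
apply/funext; apply: (fcalc_uniq (fcalc_mul fS fS K0 hK hK) fcalc_id).
by move=> t /andP[t0 _]; rewrite -expr2; exact: sqr_sqrtr.
Qed.

Lemma resolvent_exists t : ~~ (0 <= t <= M) -> exists S, [/\ bounded_op S,
  forall x, S (A x - t%:C *: x) = x & forall x, A (S x) - t%:C *: S x = x].
Proof.
move=> ht; have uc := unif_cont_on_inv (ltW M0) ht.
have [S fS] := fcalc_exists uc; have [K hK] := uc.1.
have fP := fcalc_poly ('X - t%:P).
have PE x : horner_op ('X - t%:P) A x = A x - t%:C *: x.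
  by rewrite horner_opD -polyCN horner_opX horner_opC rmorphN scaleNr.
have f1 := fcalc_poly 1; have E1 x : horner_op 1 A x = x by rewrite horner_opC scale1r.
have K0 : 0 <= K by apply: le_trans (normr_ge0 _) (hK 0 _); rewrite lexx ltW.
have st s : 0 <= s <= M -> s - t != 0.
  by rewrite subr_eq0 => hs; apply: contraNneq ht => <-.
(* [fcalc_mul] asks for one bound valid for both [(s - t)^-1] and [s - t]. *)
pose K' := Num.max K (M + `|t|).
have K'0 : 0 <= K' by rewrite /K' le_max K0.
have hK' s : 0 <= s <= M -> `|(s - t)^-1| <= K'.
  by move=> /hK h; rewrite /K' le_max h.
have hP s : 0 <= s <= M -> `|('X - t%:P).[s]| <= K'.
  move=> /andP[s0 sM]; rewrite !hornerE /K' le_max; apply/orP; right.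
  by rewrite (le_trans (ler_normB _ _))// lerD2r ger0_norm.
exists S; split; first exact: fcalc_bounded fS.
- move=> x; rewrite -PE -[RHS]E1.
  apply: (fcalc_uniq (fcalc_mul fS fP K'0 hK' hP) f1) => s hs.
  by rewrite !hornerE mulVf ?st.
- move=> x; rewrite -PE -[RHS]E1.
  apply: (fcalc_uniq (fcalc_mul fP fS K'0 hP hK') f1) => s hs.
  by rewrite !hornerE mulfV ?st.
Qed.

Lemma spectrum_itv t : spectrum A t%:C -> 0 <= t <= M.
Proof. by move=> st; apply: contra_notT st; exact: resolvent_exists. Qed.

(** A bounded inverse with bound [K] makes [A - t] bounded below by [K^-1]. *)
Lemma approx_spectrum t : ~ bounded_below (fun x => A x - t%:C *: x) ->
  spectrum A t%:C.
Proof.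
apply: contra_not => -[S [/bounded_opP[lS [K [K0 hK]]] SA _]].
exists K^-1; split=> [|x]; first by rewrite invr_gt0.
by rewrite ler_pdivrMl// -{1}(SA x).
Qed.

(** Uniform approximation on [[0, M]] restricts to the spectrum by [spectrum_itv]. *)
Lemma funcalc_exists f : unif_cont_on M f -> exists B, is_funcalc f A B.
Proof.
move=> ucf; have [B fB] := fcalc_exists ucf; exists B.
have bB := fcalc_bounded fB; split=> //.
have /choice[p_ hp] (n : nat) : exists p, approx_on p f n.+1%:R^-1 /\
    forall x, nrm (horner_op p A x - B x) <= n.+1%:R^-1 * nrm x.
  by have [p hp] := fB n.+1%:R^-1 ltac:(by []); exists p.
exists p_; split.
  apply/uniform_cvg_seqP => e /inv_nat_small[N hN]; exists N => n /hN hn t /spectrum_itv ht.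
  by rewrite (le_trans _ hn)// (hp n).1.
apply/cvg0_seqP => e /inv_nat_small[N hN]; exists N => n /hN hn.
have bp : bounded_op (fun x => horner_op (p_ n) A x - B x).
  exact: bounded_opB (bounded_horner_op _ bA) bB.
rewrite ger0_norm ?opnorm_ge0// (le_trans _ hn)// opnorm_le//.
exact: (hp n).2.
Qed.

(* Jensen's inequality, from the supporting line of [f] at [<A x, x>]. *)
Lemma is_funcalc_Jensen f B (c : R) x : is_funcalc f A B -> nrm x = 1 ->
  (forall t : R, 0 <= t -> f (rip (A x) x) + c * (t - rip (A x) x) <= f t) ->
  f (rip (A x) x) <= rip (B x) x.
Proof.
set s := rip (A x) x.
move=> [bB [p_ [/uniform_cvg_seqP pf /cvg0_seqP pB]]] x1 hc.
apply: (@ler_small _ _ _ 2) => // e e0.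
have [N1 h1] := pf _ e0; have [N2 h2] := pB _ e0; pose n := maxn N1 N2.
have bp : bounded_op (fun x => horner_op (p_ n) A x - B x).
  exact: bounded_opB (bounded_horner_op _ bA) bB.
(* The approximant raised by [e], minus the supporting line, is nonnegative on the spectrum. At the
   unit vector [x] the line contributes exactly [f s]. A second [e] is lost between [p_ n] at [A]
   and [B]. *)
have : 0 <= rip (horner_op (p_ n + ((e + c * s - f s)%:P - c *: 'X)) A x) x.
  apply: horner_op_ge0 => // t ht; have st := approx_spectrum ht.
  have /andP[t0 _] := spectrum_itv st.
  have := h1 n (leq_maxl _ _) t st; have := hc t t0.
  rewrite !hornerD hornerN hornerZ hornerC hornerX ler_norml => ? /andP[? _]; lra.
rewrite !horner_opD horner_opN horner_opZ horner_opC horner_opX !ripE ripxx x1 -/s.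
have := h2 n (leq_maxr _ _); rewrite ger0_norm ?opnorm_ge0// => hn.
have := le_trans (opnorm_bound x bp) (ler_wpM2r (nrm_ge0 x) hn).
have := rip_CauchySchwarz (horner_op (p_ n) A x - B x) x; rewrite !ripE x1; lra.
Qed.

End FunctionalCalculus.

(** * Convexity estimates for Orlicz functions *)

Section OrliczFunctions.
Variables (R : realType) (phi : R -> R).
Hypothesis hphi : orlicz phi.

Lemma orlicz_conv (l a b : R) : 0 <= l <= 1 -> 0 <= a -> 0 <= b ->
  phi (l * a + (1 - l) * b) <= l * phi a + (1 - l) * phi b.
Proof.
move=> /andP[l0 l1] a0 b0.
have := orlicz_convex hphi (Itv01 l0 l1) (x := a) (y := b).
by apply; rewrite inE /= in_itv /= andbT.
Qed.

Lemma orlicz_le (a b : R) : 0 <= a -> a <= b -> phi a <= phi b.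
Proof.
move=> a0 ab; apply: (orlicz_increasing hphi) => //; rewrite in_itv /= andbT//.
exact: le_trans ab.
Qed.

Lemma orlicz_mid (a b : R) : 0 <= a -> 0 <= b ->
  phi ((a + b) / 2) <= (phi a + phi b) / 2.
Proof.
move=> a0 b0; have h01 : 0 <= (2^-1 : R) <= 1 by lra.
have := orlicz_conv h01 a0 b0.
have -> : 2^-1 * a + (1 - 2^-1) * b = (a + b) / 2 by field.
lra.
Qed.

Lemma orlicz_chord (a b c : R) : 0 <= a -> a < b -> b < c ->
  (phi b - phi a) * (c - b) <= (phi c - phi b) * (b - a).
Proof.
move=> a0 ab bc; have ca : 0 < c - a by lra.
have h01 : 0 <= (c - b) / (c - a) <= 1.
  by rewrite divr_ge0 ?ler_pdivrMr//=; lra.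
have c0 : 0 <= c by lra.
have := orlicz_conv h01 a0 c0.
have -> : (c - b) / (c - a) * a + (1 - (c - b) / (c - a)) * c = b.
  by field; rewrite gt_eqF.
rewrite -(ler_pM2r ca).
have -> : ((c - b) / (c - a) * phi a + (1 - (c - b) / (c - a)) * phi c) * (c - a) =
  (c - b) * phi a + (b - a) * phi c by field; rewrite gt_eqF.
lra.
Qed.

(** Chord slopes increase, and the chord from [b] to [M + 1] has length at least 1 and rise at most
    [phi (M + 1)]. *)
Lemma orlicz_increment (M a b : R) : 0 <= a -> a <= b -> b <= M ->
  phi b - phi a <= phi (M + 1) * (b - a).
Proof.
move=> a0 ab bM; have [->|neq] := eqVneq a b; first by rewrite !subrr mulr0.
have {}ab : a < b by rewrite lt_neqAle neq.
have bM1 : b < M + 1 by lra.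
have := orlicz_chord a0 ab bM1.
have := orlicz_le a0 (ltW ab).
have : 0 <= phi b by apply: (orlicz_ge0 hphi); lra.
nra.
Qed.

Lemma orlicz_unif_cont (M : R) : 0 <= M -> unif_cont_on M phi.
Proof.
move=> M0; apply: (@unif_cont_on_lipschitz _ M (phi (M + 1))) => //.
  by apply: (orlicz_ge0 hphi); lra.
move=> s t /andP[s0 sM] /andP[t0 tM].
wlog st : s t s0 sM t0 tM / s <= t.
  move=> hw; have [|/ltW] := leP s t; first exact: hw.
  by rewrite distrC (distrC s); apply: hw.
rewrite distrC (distrC s) !ger0_norm ?subr_ge0//; first exact: orlicz_increment.
exact: orlicz_le.
Qed.

(** The slope is the supremum of the slopes of chords ending at [s], which the slopes of chords
    starting at [s] bound from above. At [s = 0] the slope 0 works. *)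
Lemma orlicz_supporting_line (s : R) : 0 <= s ->
  exists c : R, forall t : R, 0 <= t -> phi s + c * (t - s) <= phi t.
Proof.
rewrite le_eqVlt => /predU1P[<-|s0].
  by exists 0 => t t0; rewrite mul0r addr0 (orlicz0 hphi) (orlicz_ge0 hphi).
pose D := [set (phi s - phi a) / (s - a) | a in [set a | 0 <= a < s]]%classic.
have ubD t : s < t -> ubound D ((phi t - phi s) / (t - s)).
  move=> st _ [a /= /andP[a0 ast] <-].
  by rewrite ler_pdivrMr ?subr_gt0// mulrAC ler_pdivlMr ?subr_gt0// orlicz_chord.
have D0 : (D !=set0)%classic.
  by exists ((phi s - phi 0) / (s - 0)); exists 0 => //=; rewrite lexx.
exists (sup D) => t t0; have [ts|st|<-] := ltgtP t s; last by rewrite subrr mulr0 addr0.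
- have : (phi s - phi t) / (s - t) <= sup D.
    apply: ub_le_sup; first by exists ((phi (s + 1) - phi s) / (s + 1 - s)); apply: ubD; lra.
    by exists t => //=; rewrite t0.
  by rewrite ler_pdivrMr ?subr_gt0//; lra.
- have : sup D <= (phi t - phi s) / (t - s) by apply: ge_sup => //; apply: ubD.
  by rewrite ler_pdivlMr ?subr_gt0//; lra.
Qed.

End OrliczFunctions.

(** * Numerical radius, Buzano's inequality, mixed Schwarz inequality *)

Section NumericalRadius.
Variables (R : realType) (H : hilbertType R).
Implicit Types (x y z e : H) (P Q S T : H -> H) (phi : R -> R).

Lemma numradius_has_ubound S : bounded_op S ->
  has_ubound [set Re `|inner (S x) x| | x in [set x : H | `|x| = 1]]%classic.
Proof.
move=> /bounded_opP[_ [K [_ hK]]]; exists K => _ [x /= /eq1_nrm x1 <-].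
rewrite (le_trans (inner_CauchySchwarz _ _))// x1 mulr1.
by rewrite -[K]mulr1 -x1.
Qed.

Lemma numradius_ub S x : bounded_op S -> nrm x = 1 ->
  Re `|inner (S x) x| <= numradius S.
Proof.
move=> bS x1; apply: ub_le_sup; first exact: numradius_has_ubound.
by exists x => //=; apply/eq1_nrm.
Qed.

Lemma numradius_ge0 S : bounded_op S -> 0 <= numradius S.
Proof.
move=> bS; have [[x x1]|noH] := pselect (exists x : H, nrm x = 1).
  exact: le_trans (Re_norm_ge0 _) (numradius_ub bS x1).
rewrite /numradius (_ : [set _ | _ in _]%classic = set0) ?sup0//.
by rewrite -subset0 => _ [x /= /eq1_nrm x1 _]; apply: noH; exists x.
Qed.

(* [2 <a, e> e - a] is the reflection of [a] in the line of [e]. *)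
Lemma Buzano (a b e : H) : nrm e = 1 ->
  2 * (Re `|inner a e| * Re `|inner e b|) <= nrm a * nrm b + Re `|inner a b|.
Proof.
move=> e1; pose c := inner a e; pose r := (2%:C * c) *: e - a.
have rE : nrm r = nrm a.
  have : nrm r ^+ 2 = nrm a ^+ 2.
    apply: complexI; rewrite -!inner_nrm /r !(innerDl, innerDr, innerNl, innerNr).
    rewrite !innerZl !innerZr [inner e a]innerC -/c (inner_nrm e) e1 expr1n.
    rewrite (rmorph1 (real_complex R)) rmorphM /=.
    have -> : Num.conj (2%:C : R[i]) = 2%:C by exact: conjc_real.
    ring.
  move=> /eqP; rewrite -subr_eq0 subr_sqr mulf_eq0 => /orP[|].
    by rewrite subr_eq0 => /eqP.
  by rewrite paddr_eq0 ?nrm_ge0// => /andP[/eqP -> /eqP ->].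
have cE : 2%:C * (c * inner e b) = inner r b + inner a b.
  by rewrite /r innerDl innerNl innerZl subrK mulrA.
rewrite -Re_normM -/c.
have -> : 2 * Re `|c * inner e b| = Re `|2%:C * (c * inner e b)|.
  by rewrite [RHS]Re_normM Re_normr normr_nat.
by rewrite cE (le_trans (Re_normD _ _))// lerD2r -rE inner_CauchySchwarz.
Qed.

Lemma positive_rip P x : positive_op P -> 0 <= rip (P x) x.
Proof. by move=> [_ P0]; exact/Re_ge0/P0. Qed.

Lemma positive_CauchySchwarz Q x y : positive_op Q ->
  Re `|inner (Q x) y| ^+ 2 <= rip (Q x) x * rip (Q y) y.
Proof.
move=> pQ; have sQ := positive_selfadj pQ; have [[lQ _] _] := pQ.
have [u u1 hu] := unimodular_rotation (inner (Q x) y).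
have Qux : rip (Q (u *: x)) (u *: x) = rip (Q x) x.
  rewrite (linZ lQ) /rip innerZl innerZr mulrA -normCK norm_Re u1.
  by rewrite (rmorph1 (real_complex R)) expr1n mul1r.
rewrite -hu -innerZl -(linZ lQ) -Qux.
apply: quadratic_ge0_discr; rewrite ?positive_rip// => s.
have := positive_rip (u *: x + s%:C *: y) pQ.
rewrite (linD lQ) (linZ lQ _ y) !ripE.
rewrite (selfadj_rip y (u *: x) sQ) (ripC y) -/(rip (Q (u *: x)) y).
lra.
Qed.

Lemma positive_bound P : bounded_op P -> exists K : R, 0 < K /\
  forall x, rip (P x) x <= K * nrm x ^+ 2.
Proof.
move=> /bounded_opP[_ [K [K0 hK]]]; exists K; split=> // x.
by rewrite (le_trans (rip_CauchySchwarz _ _))// expr2 mulrA ler_wpM2r ?nrm_ge0.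
Qed.

(** On [[0, K]] the root of [t ^ 2] is [t], so [p] composed with the square is close to the identity
    there. Any positive [P] is thus recovered from its square. *)
Lemma sqrt_approx P K (p : {poly R}) (d : R) : positive_op P -> 0 < K ->
  (forall x, rip (P x) x <= K * nrm x ^+ 2) -> 0 <= d ->
  (forall t : R, 0 <= t <= K ^+ 2 -> `|p.[t] - Num.sqrt t| <= d) ->
  forall x, nrm (horner_op p (P \o P) x - P x) <= d * nrm x.
Proof.
move=> pP K0 hK d0 hp x; have bP := pP.1.
rewrite -(horner_op_comp_sqr p x bP.1) -[P x](horner_opX P x).
rewrite -horner_opN -horner_opD.
apply: (@horner_op_itv_norm _ _ _ K) => //; first exact: positive_selfadj.
  by move=> y; exact: positive_rip.
move=> t /andP[t0 tK]; rewrite hornerD hornerN hornerX horner_comp hornerXn.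
have := hp (t ^+ 2); rewrite sqrtr_sqr (ger0_norm t0); apply.
by rewrite sqr_ge0/= ler_pXn2r ?nnegrE// ltW.
Qed.

(** [T] intertwines the squares, hence every polynomial in them, and a single polynomial near the
    square root serves both [P] and [Q]. *)
Lemma positive_sqrt_intertwine P Q T : positive_op P -> positive_op Q ->
  bounded_op T -> (forall x, Q (Q (T x)) = T (P (P x))) ->
  forall x, Q (T x) = T (P x).
Proof.
move=> pP pQ bT QTP x.
have [KP [KP0 hKP]] := positive_bound pP.1.
have [KQ [KQ0 hKQ]] := positive_bound pQ.1.
have /bounded_opP[lT [L [L0 hL]]] := bT.
pose K := KP + KQ; have K0 : 0 < K by rewrite addr_gt0.
have hP y : rip (P y) y <= K * nrm y ^+ 2.
  by rewrite (le_trans (hKP y))// ler_wpM2r ?sqr_ge0// lerDl ltW.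
have hQ y : rip (Q y) y <= K * nrm y ^+ 2.
  by rewrite (le_trans (hKQ y))// ler_wpM2r ?sqr_ge0// lerDr ltW.
have K20 : 0 < K ^+ 2 by exact: exprn_gt0.
apply: nrm_eq => e e0.
apply: (@ler_small _ _ _ (nrm (T x) + L * nrm x)) => [|d d0].
  by rewrite addr_ge0 ?mulr_ge0 ?nrm_ge0// ltW.
have [p hp] := Weierstrass K20 (unif_cont_on_sqrt (ltW K20)) d0.
have h1 := sqrt_approx pP K0 hP (ltW d0) hp x.
have h2 := sqrt_approx pQ K0 hQ (ltW d0) hp (T x).
have -> : Q (T x) - T (P x) =
  T (horner_op p (P \o P) x - P x) - (horner_op p (Q \o Q) (T x) - Q (T x)).
  rewrite (@horner_op_intertwine _ _ p (P \o P) (Q \o Q) T)//.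
  by rewrite (linB lT) opprB [RHS]addrC addrA subrK.
rewrite (le_trans (nrmD _ _))// nrmN.
have := hL (horner_op p (P \o P) x - P x); have := ler_wpM2l (ltW L0) h1; lra.
Qed.

Lemma nrm_positive_sqrt P S T x : is_adjoint T S -> positive_op P ->
  (forall x, P (P x) = S (T x)) -> nrm (P x) = nrm (T x).
Proof.
move=> [_ adj] /positive_selfadj sP PP.
by apply/eqP; rewrite -(@eqrXn2 _ 2) ?nrm_ge0// -!ripxx /rip adj -PP sP.
Qed.

(* On the range of [P] this is the Cauchy-Schwarz inequality for [Q], since
   [T P = Q T]; in general [x] is split as [P z + k] with [z = (P + e)^-1 x], and
   [k = e z] is almost killed by [P], hence by [T]. *)
Lemma mixed_Schwarz P Q S T x y : bounded_op T -> is_adjoint T S ->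
  positive_op P -> positive_op Q ->
  (forall x, P (P x) = S (T x)) -> (forall x, Q (Q x) = T (S x)) ->
  Re `|inner (T x) y| ^+ 2 <= rip (P x) x * rip (Q y) y.
Proof.
move=> bT [bS adjTS] pP pQ PP QQ.
have [[lT _] sP] := (bT, positive_selfadj pP); have lP := pP.1.1.
have QT := @positive_sqrt_intertwine P Q T pP pQ bT
  (fun z => etrans (QQ _) (congr1 T (esym (PP z)))).
have range z : Re `|inner (T (P z)) y| ^+ 2 <= rip (P (P z)) (P z) * rip (Q y) y.
  rewrite -QT (le_trans (positive_CauchySchwarz _ _ pQ))//.
  rewrite ler_wpM2r ?positive_rip//.
  by rewrite QT /rip adjTS -PP -sP.
have nT z : nrm (T z) = nrm (P z) := esym (nrm_positive_sqrt z (conj bS adjTS) pP PP).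
have [K [K0 hK]] := positive_bound pP.1.
set a := Re `|inner (T x) y|; set q := rip (Q y) y.
have a0 : 0 <= a by exact: Re_norm_ge0.
have q0 : 0 <= q by exact: positive_rip.
pose X := nrm x; pose Y := nrm y.
have X0 : 0 <= X by exact: nrm_ge0.
have Y0 : 0 <= Y by exact: nrm_ge0.
(* The first term is the error in [form] below, the second comes from squaring [ab]. *)
apply: (@ler_small _ _ _ (6 * X ^+ 2 * q + 4 * a * X * Y)) => [|e e0].
  by rewrite addr_ge0 ?mulr_ge0// exprn_ge0.
have [|U [_ _ hU]] := @resolvent_exists _ _ P K pP.1 sP K0
  (fun z => positive_rip z pP) hK (- e).
  by rewrite oppr_ge0 leNgt e0.
pose z := U x; pose k := e%:C *: z.
have Pz : P z = x - k.
  by have := hU x; rewrite rmorphN scaleNr opprK => <-; rewrite addrK.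
(* Pairing [x = P z + e z] with [z] gives [e * nrm z ^ 2 <= rip x z], as [P] is positive. *)
have kX : nrm k <= X.
  rewrite nrmZr gtr0_norm//; have [->|z0] := eqVneq (nrm z) 0; first by rewrite mulr0.
  have nz : 0 < nrm z by rewrite lt_def z0 nrm_ge0.
  rewrite -(ler_pM2r nz) (le_trans _ (rip_CauchySchwarz x z))//.
  have -> : x = P z + e%:C *: z by rewrite Pz subrK.
  by rewrite ripDl ripZl ripxx expr2 mulrA lerDr positive_rip.
have PkX : nrm (P k) <= 2 * e * X.
  rewrite /k (linZ lP) nrmZr gtr0_norm// Pz.
  by have := nrmD x (- k); rewrite nrmN -/X; nra.
clearbody k; have hb := range z; set b := Re `|inner (T (P z)) y| in hb.
have ab : a <= b + 2 * e * X * Y.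
  have -> : a = Re `|inner (T (P z)) y + inner (T k) y|.
    by rewrite -innerDl -(linD lT) Pz subrK.
  rewrite (le_trans (Re_normD _ _))// lerD2l.
  by rewrite (le_trans (inner_CauchySchwarz _ _))// nT ler_wpM2r.
(* In the expansion of the form at [x - k], the cross terms cost [4 e X ^ 2] and the term in [k]
   alone costs [2 e X ^ 2]. *)
have form : rip (P (P z)) (P z) <= rip (P x) x + 6 * e * X ^+ 2.
  rewrite Pz (linB lP) !ripE (selfadj_rip x k sP) (ripC x).
  have := rip_norm_CauchySchwarz (P k) x; rewrite ler_norml => /andP[h1 _].
  have := rip_CauchySchwarz (P k) k.
  have := ler_pM (nrm_ge0 _) (nrm_ge0 _) PkX kX.
  have := ler_wpM2r X0 PkX; rewrite -/X in h1 *; nra.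
have hb2 := le_trans hb (ler_wpM2r q0 form).
have b0 : 0 <= b by exact: Re_norm_ge0.
have d0 : 0 <= 2 * e * X * Y by rewrite !mulr_ge0// ltW.
have : a ^+ 2 <= b ^+ 2 + 2 * a * (2 * e * X * Y).
  have [ad|da] := leP a (2 * e * X * Y); first by nra.
  have : 0 <= a - 2 * e * X * Y by lra.
  have : a - 2 * e * X * Y <= b by lra.
  nra.
rewrite -/q in hb2; lra.
Qed.

Lemma adjoint_bound S T x : bounded_op T -> is_adjoint T S -> rip (S (T x)) x = nrm (T x) ^+ 2.
Proof. by move=> bT [_ adj]; rewrite ripC /rip -adj inner_nrm. Qed.

Lemma abs_opP T : bounded_op T ->
  positive_op (abs_op T) /\ abs_op T \o abs_op T = adjoint T \o T.
Proof.
move=> bT; have [bS adj] := adjointP bT.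
have /bounded_opP[_ [K [K0 hK]]] := bT.
apply: (xgetPex (fun=> 0 : H) (P := [set S | positive_op S /\ S \o S = adjoint T \o T]%classic)).
apply: (@sqrt_exists _ _ _ (K ^+ 2)).
- exact: bounded_op_comp.
- by move=> x y /=; rewrite innerC -adj -innerC adj.
- exact: exprn_gt0.
- by move=> x /=; rewrite adjoint_bound ?sqr_ge0.
- move=> x /=; rewrite adjoint_bound// -exprMn ler_pXn2r ?nnegrE ?nrm_ge0//.
  by rewrite mulr_ge0 ?nrm_ge0// ltW.
Qed.

Lemma orlicz_funcalc P phi : orlicz phi -> positive_op P ->
  bounded_op (funcalc phi (P \o P)) /\
  forall x, nrm x = 1 -> phi (nrm (P x) ^+ 2) <= rip (funcalc phi (P \o P) x) x.
Proof.
move=> hphi pP; have sP := positive_selfadj pP.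
have /bounded_opP[_ [K [K0 hK]]] := pP.1.
have bPP := bounded_op_comp pP.1 pP.1.
have sPP : selfadj (P \o P) by move=> x y /=; rewrite !sP.
have K2 : 0 < K ^+ 2 by exact: exprn_gt0.
have PPE x : rip ((P \o P) x) x = nrm (P x) ^+ 2 by rewrite /= selfadj_rip// ripxx.
have PP0 x : 0 <= rip ((P \o P) x) x by rewrite PPE sqr_ge0.
have PPK x : rip ((P \o P) x) x <= K ^+ 2 * nrm x ^+ 2.
  rewrite PPE -exprMn ler_pXn2r ?nnegrE ?nrm_ge0//.
  by rewrite mulr_ge0 ?nrm_ge0// ltW.
have fB : is_funcalc phi (P \o P) (funcalc phi (P \o P)).
  apply: (xgetPex (fun=> 0 : H) (P := [set B | is_funcalc phi (P \o P) B]%classic)).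
  apply: (@funcalc_exists _ _ _ (K ^+ 2)) => //.
  exact/orlicz_unif_cont/ltW.
split=> [|x x1]; first exact: fB.1.
have [c hc] := orlicz_supporting_line hphi (PP0 x).
rewrite -PPE; exact: (is_funcalc_Jensen bPP sPP K2 PP0 PPK fB x1 hc).
Qed.

(** The supremum may not be attained, so a bound at unit vectors is carried to it by the Lipschitz
    estimate for [phi]. *)
Lemma orlicz_numradius T phi (r : R) : bounded_op T -> orlicz phi -> 0 <= r ->
  (forall x, nrm x = 1 -> phi (Re `|inner (T x) x| ^+ 2) <= r) ->
  phi (numradius T ^+ 2) <= r.
Proof.
move=> bT hphi r0 hr; set W := numradius T.
have W0 : 0 <= W by exact: numradius_ge0.
(* Without unit vectors the radius is [sup set0 = 0], and [phi 0 = 0 <= r]. *)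
have [[y y1]|noH] := pselect (exists x : H, nrm x = 1); last first.
  rewrite /W /numradius (_ : [set _ | _ in _]%classic = set0).
    by rewrite sup0 expr0n (orlicz0 hphi).
  by rewrite -subset0 => _ [x /= /eq1_nrm x1 _]; apply: noH; exists x.
have L0 : 0 <= phi (W ^+ 2 + 1).
  by apply: (orlicz_ge0 hphi); rewrite addr_ge0 ?sqr_ge0.
(* The Lipschitz constant of [phi] up to [W ^ 2], times the factor in [W ^ 2 - s ^ 2 <= e * (2 W)]
   for [s] within [e] of [W]. *)
apply: (@ler_small _ _ _ (phi (W ^+ 2 + 1) * (2 * W))) => [|e e0].
  by rewrite !mulr_ge0.
have hs : has_sup [set Re `|inner (T x) x| | x in [set x : H | `|x| = 1]]%classic.
  split; last exact: numradius_has_ubound.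
  by exists (Re `|inner (T y) y|); exists y => //=; apply/eq1_nrm.
have [_ [x xS <-] hx] := sup_adherent e0 hs.
have x1 : nrm x = 1 by apply/eq1_nrm.
have xW := numradius_ub bT x1; rewrite -/W in xW.
have := hr x x1; move: hx xW; rewrite -/(numradius T) -/W.
move: (Re_norm_ge0 (inner (T x) x)); move: (Re `|_|) => s s0 Ws sW hs2.
have sW2 : s ^+ 2 <= W ^+ 2 by rewrite ler_pXn2r ?nnegrE.
have := orlicz_increment hphi (sqr_ge0 s) sW2 (lexx _).
have : W ^+ 2 - s ^+ 2 <= e * (2 * W) by rewrite subr_sqr; apply: ler_pM; lra.
move=> /(ler_wpM2l L0); lra.
Qed.

End NumericalRadius.

Theorem theorem2p22 (R : realType) (H : hilbertType R) (T : H -> H)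
    (phi : R -> R) (hT : bounded_op T) (hphi : orlicz phi) :
  phi (numradius T ^+ 2) <=
    1 / 2 * Num.min (phi (numradius (abs_op T \o abs_op (adjoint T))))
                    (phi (numradius (T \o T)))
    + 1 / 4 * opnorm (funcalc phi (abs_op T \o abs_op T)
                      \+ funcalc phi (abs_op (adjoint T)
                                      \o abs_op (adjoint T))).
Proof.
set P := abs_op T; set S := adjoint T; set Q := abs_op S.
have adjTS : is_adjoint T S by exact: adjointP.
have [bS adj] := adjTS.
have [pP PPE] := abs_opP hT; have [pQ QQE] := abs_opP bS.
rewrite adjointK// in QQE.
have PP x : P (P x) = S (T x) by exact: (congr1 (@^~ x) PPE).
have QQ x : Q (Q x) = T (S x) by exact: (congr1 (@^~ x) QQE).
have sP := positive_selfadj pP; have sQ := positive_selfadj pQ.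
have [bB jensenB] := orlicz_funcalc hphi pP.
have [bC jensenC] := orlicz_funcalc hphi pQ.
set B := funcalc _ (P \o P) in bB jensenB *.
set C := funcalc _ (Q \o Q) in bC jensenC *.
have bBC := bounded_opD bB bC.
have nP x : nrm (P x) = nrm (T x) := nrm_positive_sqrt x adjTS pP PP.
have nQ x : nrm (Q x) = nrm (S x).
  by apply: (nrm_positive_sqrt x _ pQ QQ); rewrite -(adjointK hT); exact: adjointP.
(* Both members of the minimum enter only through such a [w]; the convexity argument is shared. *)
suff bound w : 0 <= w -> (forall x, nrm x = 1 ->
    2 * Re `|inner (T x) x| ^+ 2 <= nrm (P x) * nrm (Q x) + w) ->
    phi (numradius T ^+ 2) <= 1 / 2 * phi w + 1 / 4 * opnorm (B \+ C).
  have bPQ : bounded_op (P \o Q) by exact: bounded_op_comp pP.1 pQ.1.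
  have bTT : bounded_op (T \o T) by exact: bounded_op_comp.
  rewrite /Num.min; case: ifP => _; apply: bound; rewrite ?numradius_ge0// => x x1.
  - have mixed := mixed_Schwarz x x hT adjTS pP pQ PP QQ.
    have buz := Buzano (P x) (Q x) x1.
    have : Re `|inner (P (Q x)) x| <= _ := numradius_ub bPQ x1.
    rewrite sP innerC Re_normJ => hw.
    have h1 : rip (P x) x <= Re `|inner (P x) x| by exact: ler_Re.
    have h2 : rip (Q x) x <= Re `|inner x (Q x)|.
      by rewrite -sQ; exact: ler_Re.
    have := ler_pM (positive_rip x pP) (positive_rip x pQ) h1 h2; lra.
  (* Moving [S] across the inner product makes both factors on the left [inner (T x) x], and the
     last term [inner (T (T x)) x]. *)
  - have := Buzano (T x) (S x) x1; rewrite -!adj -expr2 nP nQ.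
    by have : Re `|inner (T (T x)) x| <= _ := numradius_ub bTT x1; lra.
move=> w0 hw; apply: orlicz_numradius => // [|x x1].
  by rewrite addr_ge0// mulr_ge0// ?(orlicz_ge0 hphi)// opnorm_ge0.
have := hw x x1; set s := Re `|_| ^+ 2; set na := nrm (P x); set nb := nrm (Q x) => hs.
have na0 : 0 <= na by exact: nrm_ge0.
have nb0 : 0 <= nb by exact: nrm_ge0.
have s0 : 0 <= s by exact: sqr_ge0.
have mid0 : 0 <= (na ^+ 2 + nb ^+ 2) / 2 by rewrite divr_ge0// addr_ge0 ?sqr_ge0.
(* The arithmetic-geometric mean inequality turns [na * nb] into a midpoint. Convexity at the two
   nested midpoints then produces the coefficients 1/2 and 1/4. *)
have s_le : s <= (w + (na ^+ 2 + nb ^+ 2) / 2) / 2.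
  by have := sqr_ge0 (na - nb); nra.
have h1 := orlicz_le hphi s0 s_le; have h2 := orlicz_mid hphi w0 mid0.
have h3 := orlicz_mid hphi (sqr_ge0 na) (sqr_ge0 nb).
have := jensenB x x1; have := jensenC x x1; rewrite -/na -/nb.
have := rip_CauchySchwarz ((B \+ C) x) x.
have x1' : nrm x <= 1 by rewrite x1.
have := opnorm_ub bBC x1'; rewrite x1 mulr1 /= ripDl.
lra.
Qed.
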